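(* Assume (a)–(d) of the context, that the system has a global convex entropy, and that for each fixed $U_{II}$ the map $U_I\mapsto f_I(U_I,U_{II})$ is globally one-to-one. Let $U_0=(U_{0I},U_{0II})\in\mathcal U$ and consider constant data $U_{1II}=U_{0II}$. Then solutions of $$ (f(\hat U))_x=(B(\hat U)\hat U_x)_x\ \ (0<x<1),\qquad \hat U(0)=U_0,\qquad \hat U_{II}(1)=U_{0II}, $$ are globally unique, and consist exclusively of constant states: the only solution $\hat U:[0,1]\to\mathcal U$ is $\hat U\equiv U_0$. Moreover this solution is nondegenerate (the corresponding root $C_2=0$ of the map $\Psi$ of the context has $d\Psi(0)$ of full rank) and spectrally stable.
   Context: Setting. $\mathcal U\subset\mathbb R^n$ is an open set of states $U=(U_I,U_{II})\in\mathbb R^r\times\mathbb R^{n-r}$. Consider $\partial_t f^0(U)+f(U)_x=(B(U)U_x)_x$ on $0<x<1$ with boundary conditions $U(0)=U_0$, $U_{II}(1)=U_{1II}$. Here $f^0=(f^0_I,f^0_{II})$ and $f=(f_I,f_{II})$ take values in $\mathbb R^r\times\mathbb R^{n-r}$, $B=\begin{pmatrix} 0 & 0 \\ 0 & B_{22} \end{pmatrix}$ with $B_{22}(U)\in M_{n-r}(\mathbb R)$. Write $A^0=df^0=\begin{pmatrix} \mathrm{Id}_r & 0 \\ A^0_{21} & A^0_{22} \end{pmatrix}$ (invertible, with $\det A^0_{22}>0$) and $A=df=\begin{pmatrix} A_{11} & A_{12} \\ A_{21} & A_{22} \end{pmatrix}$ with $A_{11}\in M_r(\mathbb R)$. Assumptions,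 for every $U\in\mathcal U$: (a) $f^0$, $f$, $B$ are smooth. (b) $(A^0_{22})^{-1}B_{22}+((A^0_{22})^{-1}B_{22})^T$ has positive eigenvalues. (c) The eigenvalues of $A_{11}(U)=(df_I)_I(U)$ are real and positive. (d) (Symmetrizability) There is a smooth block-diagonal matrix function $S(U)=\begin{pmatrix} S_{11}(U) & 0 \\ 0 & S_{22}(U) \end{pmatrix}$ such that $S A^0$ is symmetric positive definite, $SA$ is symmetric, and $S_{22}B_{22}+(S_{22}B_{22})^T>0$. Convex entropy. A global convex entropy is a pair of smooth real functions $(\eta,q)$ of the variable $w=f^0(U)$ such that, at $w=f^0(U)$ for all $U\in\mathcal U$: the Hessian $\frac{d^2\eta}{dw^2}$ is positive definite; $\frac{d\eta}{dw}\, df(U)\,(df^0(U))^{-1}=\frac{dq}{dw}$; and the symmetric matrix $M+M^T$, with $M=(df^0)^T\frac{d^2\eta}{dw^2}B$, is positive semidefinite, with $v^T(M+M^T)v=0$ only for $v\in\ker B$. The map $\Psi$. For fixed $U_0$, $U_{1II}$, and $C_2\in\mathbb R^{n-r}$, let $U$ be the maximal solution with $U(0)=U_0$ of $$B_{22}(U)U_{II}'=f_{II}(U)-f_{II}(U_0)+B_{22}(U_0)C_2,\qquad f_I(U)=f_I(U_0).$$ $\Psi$ is defined on the set of $C_2$ for which $U$ is defined on $[0,1]$, by $\Psi(C_2)=U_{II}(1)-U_{1II}$. Steady solutions correspond to roots $C_2=\hat U_{II}'(0)$ of $\Psi$. Spectral stability of $\hat U$ means that for every $\lambda\in\mathbb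 C$ with $\Re\lambda\ge0$ the linearized eigenvalue problem $$\lambda A^0(\hat U)V+(A(\hat U)V)_x=\big(B(\hat U)V_x+(dB(\hat U)V)\hat U_x\big)_x,\quad V(0)=0,\ V_{II}(1)=0$$ on $(0,1)$ has only the trivial solution $V\equiv0$. *)

(* Defs.v *)
From HB Require Import structures.
From mathcomp Require Import all_boot all_order all_algebra.
From mathcomp Require Import all_classical all_reals all_analysis.
From mathcomp Require Import complex.

Set Implicit Arguments.
Unset Strict Implicit.
Unset Printing Implicit Defensive.

Import Order.TTheory GRing.Theory Num.Theory.
Import numFieldNormedType.Exports.

Local Open Scope classical_set_scope.
Local Open Scope ring_scope.
Local Open Scope complex_scope.

Section Calculus.
Variable R : realType.

(* C^infinity: every iterated directional derivative is (Frechet)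
   differentiable at every point of A; A is meant to be open. *)
Definition smooth_on (V W : normedModType R) (A : set V) (g : V -> W) : Prop :=
  forall (vs : seq V) (x : V), A x ->
    differentiable (foldr (fun v h => (fun y => 'D_v h y)) g vs) x.

(* Jacobian matrix acting on column vectors; the library's [jacobian] is its
   transpose, for maps between spaces of row vectors. *)
Definition Jac (n p : nat) (g : 'cV[R]_n -> 'cV[R]_p) (x : 'cV[R]_n) :
    'M[R]_(p, n) :=
  \matrix_(i < p, j < n) ('D_(delta_mx j 0) g x) i 0.

Definition drow (n : nat) (h : 'cV[R]_n -> R) (w : 'cV[R]_n) : 'rV[R]_n :=
  \row_(j < n) 'D_(delta_mx j 0) h w.

Definition hessian (n : nat) (h : 'cV[R]_n -> R) (w : 'cV[R]_n) : 'M[R]_n :=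
  \matrix_(i < n, j < n)
    'D_(delta_mx i 0) (fun y => 'D_(delta_mx j 0) h y) w.

Definition symmx (n : nat) (M : 'M[R]_n) : Prop := M^T = M.

Definition qform (n : nat) (M : 'M[R]_n) (v : 'cV[R]_n) : R :=
  (v^T *m M *m v) 0 0.

Definition posdefmx (n : nat) (M : 'M[R]_n) : Prop :=
  symmx M /\ forall v : 'cV[R]_n, v != 0 -> 0 < qform M v.

Definition mxC (n p : nat) (M : 'M[R]_(n, p)) : 'M[R[i]]_(n, p) :=
  map_mx (real_complex R) M.

Definition pos_eigenvalues (n : nat) (M : 'M[R]_n) : Prop :=
  forall z : R[i], eigenvalue (mxC M) z ->
    complex.Im z = 0 /\ 0 < complex.Re z.

(* Functions of a real variable with values in C^n: continuity and
    derivatives are those of the real and imaginary parts. *)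

Definition mxRe (n p : nat) (M : 'M[R[i]]_(n, p)) : 'M[R]_(n, p) :=
  map_mx (@complex.Re R) M.
Definition mxIm (n p : nat) (M : 'M[R[i]]_(n, p)) : 'M[R]_(n, p) :=
  map_mx (@complex.Im R) M.

Definition ccontinuous01 (n : nat) (V : R -> 'cV[R[i]]_n) : Prop :=
  {within `[0, 1], continuous (fun x : R => mxRe (V x))} /\
  {within `[0, 1], continuous (fun x : R => mxIm (V x))}.

Definition cderivable (n : nat) (V : R -> 'cV[R[i]]_n) (x : R) : Prop :=
  derivable (fun y : R => mxRe (V y)) x 1 /\ derivable (fun y : R => mxIm (V y)) x 1.

Definition cderive1 (n : nat) (V : R -> 'cV[R[i]]_n) (x : R) : 'cV[R[i]]_n :=
  mxC (derive1 (fun y : R => mxRe (V y)) x)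
  + 'i%C *: mxC (derive1 (fun y : R => mxIm (V y)) x).

End Calculus.

(* The system d_t f0(U) + f(U)_x = (B(U) U_x)_x, with f = [flux].  States are
   U = (U_I, U_II) in R^r x R^m, with m = n - r, so that
   U_I = usubmx U and U_II = dsubmx U.  The maps are total functions; only
   their restrictions to the open set [states] matter. *)
Record system (R : realType) (r m : nat) := System {
  states : set 'cV[R]_(r + m);
  f0 : 'cV[R]_(r + m) -> 'cV[R]_(r + m);
  flux : 'cV[R]_(r + m) -> 'cV[R]_(r + m);
  B22 : 'cV[R]_(r + m) -> 'M[R]_m
}.

Section System.
Variables (R : realType) (r m : nat) (s : system R r m).

Let state := 'cV[R]_(r + m).

Definition B (U : state) : 'M[R]_(r + m) := block_mx 0 0 0 (B22 s U).
Definition A0 (U : state) : 'M[R]_(r + m) := Jac (f0 s) U.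
Definition A (U : state) : 'M[R]_(r + m) := Jac (flux s) U.

Definition A0_structure : Prop :=
  forall U, states s U ->
    [/\ ulsubmx (A0 U) = 1%:M, ursubmx (A0 U) = 0, A0 U \in unitmx
      & 0 < \det (drsubmx (A0 U))].

Definition smooth_system : Prop :=
  [/\ smooth_on (states s) (f0 s), smooth_on (states s) (flux s)
    & smooth_on (states s) B].

Definition parabolicity : Prop :=
  forall U, states s U ->
    let N := invmx (drsubmx (A0 U)) *m B22 s U in pos_eigenvalues (N + N^T).

Definition hyperbolicity : Prop :=
  forall U, states s U -> pos_eigenvalues (ulsubmx (A U)).

Definition symmetrizable : Prop :=
  exists (S11 : state -> 'M[R]_r) (S22 : state -> 'M[R]_m),
    let S U : 'M[R]_(r + m) := block_mx (S11 U) 0 0 (S22 U) in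
    smooth_on (states s) S /\
    forall U, states s U ->
      [/\ posdefmx (S U *m A0 U), symmx (S U *m A U)
        & posdefmx (S22 U *m B22 s U + (S22 U *m B22 s U)^T)].

Definition convex_entropy (eta q : state -> R) : Prop :=
  [/\ smooth_on (f0 s @` states s) eta,
      smooth_on (f0 s @` states s) q
    & forall U, states s U ->
      let w := f0 s U in
      let M := (A0 U)^T *m hessian eta w *m B U in
      [/\ posdefmx (hessian eta w),
          drow eta w *m A U *m invmx (A0 U) = drow q w,
          forall v, 0 <= qform (M + M^T) v
        & forall v, qform (M + M^T) v = 0 -> B U *m v = 0]].

Definition has_convex_entropy : Prop := exists eta q, convex_entropy eta q.

Definition fI_injective : Prop :=
  forall UII : 'cV[R]_m,
    set_inj [set UI : 'cV[R]_r | states s (col_mx UI UII)]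
            (fun UI => usubmx (flux s (col_mx UI UII))).

(* Classical solutions: continuous up to the boundary, with the differential
   equation holding pointwise in the open interval. *)
Definition steady_solution (U0 : state) (U1II : 'cV[R]_m) (U : R -> state) :
    Prop :=
  [/\ forall x : R, x \in `[0, 1] -> states s (U x),
      {within `[0, 1], continuous U},
      forall x : R, x \in `]0, 1[ ->
        [/\ derivable U x 1,
            derivable (fun y : R => B (U y) *m derive1 U y) x 1
          & derive1 (fun y : R => flux s (U y)) x
            = derive1 (fun y : R => B (U y) *m derive1 U y) x],
      U 0 = U0
    & dsubmx (U 1) = U1II].

(* Restrictions to [0, 1] of solutions of the initial value problem with
   parameter C2; the maximal solution is defined on [0, 1] exactly when this
   set is nonempty, and its members then all agree with it on [0, 1]. *)
Definition shoot (U0 : state) (C2 : 'cV[R]_m) : set (R -> state) :=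
  [set U : R -> state | [/\ forall x : R, x \in `[0, 1] -> states s (U x),
      {within `[0, 1], continuous U},
      U 0 = U0,
      forall x : R, x \in `[0, 1] -> usubmx (flux s (U x)) = usubmx (flux s U0)
    & forall x : R, x \in `]0, 1[ ->
        derivable (fun y : R => dsubmx (U y)) x 1 /\
        B22 s (U x) *m derive1 (fun y : R => dsubmx (U y)) x
        = dsubmx (flux s (U x)) - dsubmx (flux s U0) + B22 s U0 *m C2]].

Definition Psi_dom (U0 : state) : set 'cV[R]_m :=
  [set C2 | shoot U0 C2 !=set0].

Definition Psi (U0 : state) (U1II : 'cV[R]_m) (C2 : 'cV[R]_m) : 'cV[R]_m :=
  xget 0 [set dsubmx (U 1) - U1II | U in shoot U0 C2].

(* Being a neighborhood of C2 and differentiability there are what give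
   d Psi(C2) its meaning. *)
Definition nondegenerate_root (U0 : state) (U1II C2 : 'cV[R]_m) : Prop :=
  [/\ nbhs C2 (Psi_dom U0),
      Psi U0 U1II C2 = 0,
      differentiable (Psi U0 U1II) C2
    & \rank (Jac (Psi U0 U1II) C2) = m].

(* dB(U) V for a complex vector V. *)
Definition dB (U : state) (V : 'cV[R[i]]_(r + m)) : 'M[R[i]]_(r + m) :=
  \sum_(j < r + m) V j 0 *: mxC ('D_(delta_mx j 0) B U).

Definition eigensolution (Uhat : R -> state) (lambda : R[i])
    (V : R -> 'cV[R[i]]_(r + m)) : Prop :=
  let AV y := mxC (A (Uhat y)) *m V y in
  let BV y := mxC (B (Uhat y)) *m cderive1 V y
              + dB (Uhat y) (V y) *m mxC (derive1 Uhat y) in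
  [/\ ccontinuous01 V,
      forall x : R, x \in `]0, 1[ ->
        [/\ cderivable V x, cderivable AV x, cderivable BV x
          & lambda *: (mxC (A0 (Uhat x)) *m V x) + cderive1 AV x
            = cderive1 BV x],
      V 0 = 0
    & dsubmx (V 1) = 0].

Definition spectrally_stable (Uhat : R -> state) : Prop :=
  forall lambda : R[i], 0 <= complex.Re lambda ->
  forall V, eigensolution Uhat lambda V -> forall x : R, x \in `[0, 1] -> V x = 0.

End System.

(* Main.v *)
(** Along a steady solution the flux balance [f(U) - B(U) U' = c] shows that
    [f_I(U)] is constant, so injectivity of [f_I] gives [U(1) = U(0)]; the entropy
    inequality then forces [B(U) U' = 0], hence [U' = 0].

    Nondegeneracy: near [U0] the shooting problem is [v' = F(v, C)] with
    [v = U_II - U0_II], and [Psi] is approximated to first order by [Z(1)], where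
    [Z' = K Z + 1] and [Z(0) = 0]. The symmetrizer makes [P K] symmetric for a
    matrix [P] with positive symmetric part, and an energy identity shows that
    [Z(1)] is injective.

    Spectral stability: the symmetrizer gives an energy balance for the
    eigenvalue problem, whose boundary term at [x = 1] has a sign because
    [S11 A11] is positive definite. *)
Require Import Defs.
From mathcomp Require Import all_boot all_order all_algebra.
From mathcomp Require Import all_classical all_reals all_analysis.
From mathcomp Require Import complex ring lra.
Import Order.TTheory GRing.Theory Num.Theory.
Import numFieldNormedType.Exports.
Local Open Scope classical_set_scope.
Local Open Scope ring_scope.
Set Implicit Arguments.
Unset Strict Implicit.
Unset Printing Implicit Defensive.

(** * Matrix-valued functions of one variable *)

Section MatrixCalculus.
Context {R : realType}.

(** Steady states and eigenfunctions have derivatives only inside the interval, while the energy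
    arguments compare values at 0 and 1. Each energy is therefore written with a substitute for
    [B(U) U'] that is continuous up to the boundary: the flux minus its constant for steady states,
    an antiderivative plus [A V] for eigenfunctions. In each case the derivative is nonnegative and
    the boundary data prevent the energy from growing, so the dissipation vanishes identically.

    For nondegeneracy the obstacle is that [Psi] takes its value from an unspecified member of
    [shoot], which is not known in advance to stay near [U0]. The expansion of [Psi] is therefore
    proved for every solution with small [C2], after an exit-time argument confines all of them to a
    small ball. Existence for small [C2] is obtained by truncating the problem outside a ball, so
    that it becomes globally Lipschitz and has a solution on all of [[0, 1]]. *)

Lemma mx_norm_leP p q (M : 'M[R]_(p, q)) (e : R) : 0 <= e ->
  (`|M| <= e) <-> (forall i j, `|M i j| <= e).
Proof.
move=> e0; rewrite [`|M|]mx_normrE; split=> [/bigmax_leP[_ h] i j|h].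
  exact: (h (i, j)).
by apply/bigmax_leP; split=> // -[i j] _; exact: h.
Qed.

Lemma mx_norm_entry p q (M : 'M[R]_(p, q)) i j : `|M i j| <= `|M|.
Proof. by move: i j; apply/mx_norm_leP. Qed.

Lemma mx_norm_mulmx p q k (A : 'M[R]_(p, q)) (B : 'M[R]_(q, k)) :
  `|A *m B| <= q%:R * `|A| * `|B|.
Proof.
apply/mx_norm_leP=> [|i j]; first by rewrite !mulr_ge0.
rewrite mxE (le_trans (ler_norm_sum _ _ _))//.
rewrite (@le_trans _ _ (\sum_(l < q) `|A| * `|B|))//; last first.
  by rewrite sumr_const card_ord -mulrA mulr_natl.
by apply: ler_sum => l _; rewrite normrM ler_pM// mx_norm_entry.
Qed.

Lemma mx_norm_dsubmx p q k (A : 'M[R]_(p + q, k)) : `|dsubmx A| <= `|A|.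
Proof.
by apply/mx_norm_leP => // i j; rewrite mxE; exact: mx_norm_entry.
Qed.

Lemma cvg_mxP {T : Type} {F : set_system T} {FF : Filter F} p q
    (f : T -> 'M[R]_(p, q)) (A : 'M[R]_(p, q)) :
  f @ F --> A <-> forall i j, (fun t => f t i j) @ F --> A i j.
Proof.
split=> [fA i j|fA].
  exact: (cvg_comp _ _ fA (@coord_continuous _ _ _ i j A)).
apply/cvgrPdist_le => e e0.
have : \forall t \near F, forall i j, `|A i j - f t i j| <= e.
  apply: filter_forall => i; apply: filter_forall => j.
  by have /cvgrPdist_le := fA i j; exact.
apply: filterS => t h; apply/mx_norm_leP => [|i j]; first exact: ltW.
by rewrite !mxE.
Qed.

Lemma cvg_mulmx {T : Type} {F : set_system T} {FF : Filter F} p q k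
    (f : T -> 'M[R]_(p, q)) (g : T -> 'M[R]_(q, k))
    (A : 'M[R]_(p, q)) (B : 'M[R]_(q, k)) :
  f @ F --> A -> g @ F --> B -> (fun t => f t *m g t) @ F --> A *m B.
Proof.
move=> /cvg_mxP fA /cvg_mxP gB; apply/cvg_mxP => i j.
rewrite mxE; under eq_fun do rewrite mxE.
by apply: (cvg_big add_continuous) => l _; exact: cvgM.
Qed.

Lemma cvg_trmx {T : Type} {F : set_system T} {FF : Filter F} p q
    (f : T -> 'M[R]_(p, q)) (A : 'M[R]_(p, q)) :
  f @ F --> A -> (fun t => (f t)^T) @ F --> A^T.
Proof.
move=> /cvg_mxP fA; apply/cvg_mxP => i j.
by rewrite mxE; under eq_fun do rewrite mxE; exact: fA.
Qed.

Lemma cvg_usubmx {T : Type} {F : set_system T} {FF : Filter F} p q k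
    (f : T -> 'M[R]_(p + q, k)) (A : 'M[R]_(p + q, k)) :
  f @ F --> A -> (fun t => usubmx (f t)) @ F --> usubmx A.
Proof.
move=> /cvg_mxP fA; apply/cvg_mxP => i j.
by rewrite mxE; under eq_fun do rewrite mxE; exact: fA.
Qed.

Lemma cvg_dsubmx {T : Type} {F : set_system T} {FF : Filter F} p q k
    (f : T -> 'M[R]_(p + q, k)) (A : 'M[R]_(p + q, k)) :
  f @ F --> A -> (fun t => dsubmx (f t)) @ F --> dsubmx A.
Proof.
move=> /cvg_mxP fA; apply/cvg_mxP => i j.
by rewrite mxE; under eq_fun do rewrite mxE; exact: fA.
Qed.

Section Derive.
Context {V : normedModType R}.
Implicit Types x v : V.

Lemma is_derive_mxP p q (f : V -> 'M[R]_(p, q)) x v (D : 'M[R]_(p, q)) :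
  is_derive x v f D <-> forall i j, is_derive x v (fun t => f t i j) (D i j).
Proof.
split=> [[fx fD] i j|h].
  have /derivableP hd := (derivable_mxP f x v).1 fx i j.
  by apply: (is_derive_eq hd); rewrite -fD derive_mx// mxE.
have fx : derivable f x v by apply/derivable_mxP => i j; have [] := h i j.
split=> //; rewrite derive_mx//; apply/matrixP => i j; rewrite mxE.
by have [] := h i j.
Qed.

Lemma is_derive_mulmx p q k (f : V -> 'M[R]_(p, q)) (g : V -> 'M[R]_(q, k))
    x v df dg :
  is_derive x v f df -> is_derive x v g dg ->
  is_derive x v (fun t => f t *m g t) (df *m g x + f x *m dg).
Proof.
move=> /is_derive_mxP hf /is_derive_mxP hg; apply/is_derive_mxP => i j.
have -> : (fun t => (f t *m g t) i j) =
    \sum_(l < q) ((fun t => f t i l) * (fun t => g t l j)).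
  by apply/funext => t; rewrite mxE fct_sumE.
apply: (is_derive_eq (is_derive_sum (fun l => is_deriveM (hf i l) (hg l j)))).
rewrite !mxE -big_split/=; apply: eq_bigr => l _.
by rewrite /GRing.scale/= addrC [f x i l * _]mulrC [_ * df i l]mulrC.
Qed.

Lemma is_derive_mulmxl p q k (A : 'M[R]_(p, q)) (g : V -> 'M[R]_(q, k)) x v dg :
  is_derive x v g dg -> is_derive x v (fun t => A *m g t) (A *m dg).
Proof.
move=> hg; apply: (is_derive_eq (is_derive_mulmx (is_derive_cst A x v) hg)).
by rewrite mul0mx add0r.
Qed.

Lemma is_derive_mulmxr p q k (f : V -> 'M[R]_(p, q)) (A : 'M[R]_(q, k)) x v df :
  is_derive x v f df -> is_derive x v (fun t => f t *m A) (df *m A).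
Proof.
move=> hf; apply: (is_derive_eq (is_derive_mulmx hf (is_derive_cst A x v))).
by rewrite mulmx0 addr0.
Qed.

Lemma is_derive_trmx p q (f : V -> 'M[R]_(p, q)) x v df :
  is_derive x v f df -> is_derive x v (fun t => (f t)^T) df^T.
Proof.
move=> /is_derive_mxP h; apply/is_derive_mxP => i j.
by rewrite mxE; under eq_fun do rewrite mxE; exact: h.
Qed.

Lemma is_derive_usubmx p q k (f : V -> 'M[R]_(p + q, k)) x v df :
  is_derive x v f df -> is_derive x v (fun t => usubmx (f t)) (usubmx df).
Proof.
move=> /is_derive_mxP h; apply/is_derive_mxP => i j.
by rewrite mxE; under eq_fun do rewrite mxE; exact: h.
Qed.

Lemma is_derive_dsubmx p q k (f : V -> 'M[R]_(p + q, k)) x v df :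
  is_derive x v f df -> is_derive x v (fun t => dsubmx (f t)) (dsubmx df).
Proof.
move=> /is_derive_mxP h; apply/is_derive_mxP => i j.
by rewrite mxE; under eq_fun do rewrite mxE; exact: h.
Qed.

End Derive.

Lemma is_derive_derive1 p q (f : R -> 'M[R]_(p, q)) (x : R) :
  derivable f x 1 -> is_derive x 1 f (derive1 f x).
Proof. by move=> fx; rewrite derive1E; exact: derivableP. Qed.

Lemma is_derive1_val p q (f : R -> 'M[R]_(p, q)) (x : R) D :
  is_derive x 1 f D -> derive1 f x = D.
Proof. by move=> [_ <-]; rewrite derive1E. Qed.

Lemma is_derive_near p q (f g : R -> 'M[R]_(p, q)) (a b x : R) D :
  x \in `]a, b[ -> (forall t, t \in `]a, b[ -> f t = g t) ->
  is_derive x 1 f D -> is_derive x 1 g D.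
Proof.
move=> xab fg; apply: near_eq_is_derive.
by near=> t; apply/fg; near: t; exact: near_in_itvoo.
Unshelve. all: by end_near. Qed.

End MatrixCalculus.

(** * Monotonicity, constancy and growth on an interval *)

Section OneVariable.
Context {R : realType}.
Implicit Types (f df : R -> R) (a b : R).

Lemma derive_ge0_le f df a b :
  {within `[a, b], continuous f} ->
  (forall x : R, x \in `]a, b[ -> is_derive x 1 f (df x)) ->
  (forall x : R, x \in `]a, b[ -> 0 <= df x) ->
  forall x y, a <= x -> x <= y -> y <= b -> f x <= f y.
Proof.
move=> cf hf df0 x y ax xy yb.
apply: (@ger0_derive1_le_cc _ f a b) => //.
- by move=> z /hf [].
- by move=> z zab; have [_ h] := hf z zab; rewrite derive1E h df0.
- by rewrite in_itv/= ax (le_trans xy).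
- by rewrite in_itv/= yb (le_trans ax).
Qed.

(** Monotonicity squeezes every value between those at the ends. The energy arguments for steady
    states, for eigenfunctions and for the linear shooting problem all end here: the dissipation is
    [df], and the boundary conditions give [f b <= f a]. *)
Lemma derive_ge0_eq0 f df a b : a < b ->
  {within `[a, b], continuous f} ->
  (forall x : R, x \in `]a, b[ -> is_derive x 1 f (df x)) ->
  (forall x : R, x \in `]a, b[ -> 0 <= df x) ->
  f b <= f a ->
  (forall x : R, x \in `]a, b[ -> df x = 0) /\ f a = f b.
Proof.
move=> ab cf hf df0 fba.
have mono := derive_ge0_le cf hf df0.
have fE x : x \in `[a, b] -> f x = f a.
  rewrite in_itv/= => /andP[ax xb].
  by apply/le_anti; rewrite (mono a x)// (le_trans (mono x b _ _ _)).
split=> [x xab|]; last by rewrite fE// in_itv/= lexx ltW.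
have [_ <-] := hf x xab.
have [_ <-] : is_derive x 1 f 0.
  have : is_derive x 1 (cst (f a)) (0 : R) by apply: is_derive_cst.
  apply: near_eq_is_derive.
  near=> t; rewrite fE//; apply: subset_itv_oo_cc.
  by near: t; exact: near_in_itvoo.
by [].
Unshelve. all: by end_near. Qed.

Lemma derive0_cst p q (f : R -> 'M[R]_(p, q)) a b :
  {within `[a, b], continuous f} ->
  (forall x : R, x \in `]a, b[ -> is_derive x 1 f 0) ->
  forall x : R, x \in `[a, b] -> f x = f a.
Proof.
move=> cf hf x; rewrite in_itv/= => /andP[ax xb]; apply/matrixP => i j.
have ci : {within `[a, b], continuous (fun t => f t i j)}.
  by move=> t; have /cvg_mxP := cf t; exact.
have di t : t \in `]a, b[ -> is_derive t 1 (fun t => f t i j) 0.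
  by move=> /hf/is_derive_mxP/(_ i j); rewrite mxE.
have cNi : {within `[a, b], continuous (fun t => - f t i j)}.
  by move=> t; apply: cvgN; exact: ci.
have dNi t : t \in `]a, b[ -> is_derive t 1 (fun t => - f t i j) 0.
  by move=> /di dt; apply: (is_derive_eq (is_deriveN dt)); rewrite oppr0.
apply/le_anti/andP; split; last exact: (derive_ge0_le ci di).
by rewrite -lerN2; exact: (derive_ge0_le cNi dNi).
Qed.

(** Meant for quantities such as [B(U) U'] that are not controlled at the ends of the interval. *)
Lemma derive0_cst_oo p q (f : R -> 'M[R]_(p, q)) a b :
  (forall x : R, x \in `]a, b[ -> is_derive x 1 f 0) ->
  forall x y, x \in `]a, b[ -> y \in `]a, b[ -> f x = f y.
Proof.
move=> hf; suff h x y : x \in `]a, b[ -> y \in `]a, b[ -> x <= y -> f y = f x.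
  by move=> x y xab yab; have [xy|/ltW yx] := leP x y; [apply/esym|]; exact: h.
rewrite !in_itv/= => /andP[ax xb] /andP[ay yb] xy.
have sub t : x <= t -> t <= y -> is_derive t 1 f 0.
  move=> xt ty; apply: hf.
  by rewrite in_itv/= (lt_le_trans ax)//= (le_lt_trans ty).
have cf : {within `[x, y], continuous f}.
  apply: derivable_within_continuous => t; rewrite in_itv/= => /andP[xt ty].
  by have [] := sub t xt ty.
have df t : t \in `]x, y[ -> is_derive t 1 f 0.
  by rewrite in_itv/= => /andP[/ltW xt /ltW ty]; exact: sub.
have yxy : y \in `[x, y] by rewrite in_itv/= xy lexx.
exact: derive0_cst cf df y yxy.
Qed.

Lemma is_derive_expR_scale (l c x : R) : l != 0 ->
  is_derive x 1 (fun t => c / l * expR (l * t)) (c * expR (l * x)).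
Proof.
move=> l0; apply: is_derive_eq.
by rewrite /GRing.scale/=; field.
Qed.

(** Entrywise comparison with [E], a primitive of the bound: [E + v] and [E - v] are nondecreasing
    and nonnegative at 0. Integration thus costs a factor [1 / l] in the norm weighted by
    [expR (- (l * x))], and [l] can be chosen large enough to absorb a Lipschitz constant. *)
Lemma exp_growth p q (v dv : R -> 'M[R]_(p, q)) (a c l : R) :
  0 < l -> 0 <= c ->
  {within `[0, a], continuous v} -> v 0 = 0 ->
  (forall x : R, x \in `]0, a[ -> is_derive x 1 v (dv x)) ->
  (forall x : R, x \in `]0, a[ -> `|dv x| <= c * expR (l * x)) ->
  forall x : R, x \in `[0, a] -> `|v x| <= c / l * expR (l * x).
Proof.
move=> l0 c0 cv v0 hv hdv x; rewrite in_itv/= => /andP[x0 xa].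
apply/mx_norm_leP => [|i j]; first by rewrite mulr_ge0 ?expR_ge0// divr_ge0// ltW.
have l0' : l != 0 by rewrite gt_eqF.
have ci : {within `[0, a], continuous (fun t => v t i j)}.
  by move=> t; have /cvg_mxP := cv t; exact.
have ce : {within `[0, a], continuous (fun t => c / l * expR (l * t))}.
  apply: derivable_within_continuous => t _.
  by have [] := is_derive_expR_scale c t l0'.
have di t : t \in `]0, a[ -> is_derive t 1 (fun t => v t i j) (dv t i j).
  by move=> /hv/is_derive_mxP.
have bi t : t \in `]0, a[ -> `|dv t i j| <= c * expR (l * t).
  by move=> ta; rewrite (le_trans (mx_norm_entry _ _ _))// hdv.
pose E t := c / l * expR (l * t).
have dE (t : R) : is_derive t 1 E (c * expR (l * t)) := is_derive_expR_scale c t l0'.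
have cD : {within `[0, a], continuous (fun t => v t i j + E t)}.
  by move=> t; apply: cvgD; [exact: ci|exact: ce].
have cB : {within `[0, a], continuous (fun t => E t - v t i j)}.
  by move=> t; apply: cvgB; [exact: ce|exact: ci].
have dD (t : R) : t \in `]0, a[ ->
    is_derive t 1 (fun t => v t i j + E t) (dv t i j + c * expR (l * t)).
  by move=> /di dt; exact: (is_deriveD dt (dE t)).
have dB (t : R) : t \in `]0, a[ ->
    is_derive t 1 (fun t => E t - v t i j) (c * expR (l * t) - dv t i j).
  by move=> /di dt; exact: (is_deriveB (dE t) dt).
have D0 (t : R) : t \in `]0, a[ -> 0 <= dv t i j + c * expR (l * t).
  by move=> /bi; rewrite ler_norml => /andP[+ _]; rewrite -subr_ge0 opprK.
have B0 (t : R) : t \in `]0, a[ -> 0 <= c * expR (l * t) - dv t i j.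
  by move=> /bi; rewrite ler_norml => /andP[_ +]; rewrite -subr_ge0.
have E0 : 0 <= E 0 by rewrite /E mulr0 expR0 mulr1 divr_ge0// ltW.
have := derive_ge0_le cD dD D0 (lexx 0) x0 xa.
have := derive_ge0_le cB dB B0 (lexx 0) x0 xa.
rewrite v0 mxE add0r subr0 -/(E x) => h1 h2.
by rewrite ler_norml -[X in X && _]subr_ge0 opprK -[X in _ && X]subr_ge0
  (le_trans E0 h1) (le_trans E0 h2).
Qed.

(* With [S] the maximum of [`|v x| expR (- (L + 1) x)], the previous bound gives
   [S <= (L S + M) / (L + 1)], that is [S <= M]. *)
Lemma gronwall p q (v dv : R -> 'M[R]_(p, q)) (a L M : R) :
  0 <= L -> 0 <= M ->
  {within `[0, a], continuous v} -> v 0 = 0 ->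
  (forall x : R, x \in `]0, a[ -> is_derive x 1 v (dv x)) ->
  (forall x : R, x \in `]0, a[ -> `|dv x| <= L * `|v x| + M) ->
  forall x : R, x \in `[0, a] -> `|v x| <= M * expR ((L + 1) * x).
Proof.
move=> L0 M0 cv v0 hv hdv x xa.
have a0 : 0 <= a by move: xa; rewrite in_itv/= => /andP[]; exact: le_trans.
have l0 : 0 < L + 1 by rewrite ltr_wpDl.
pose g t := `|v t| * expR (- ((L + 1) * t)).
have cg : {within `[0, a], continuous g}.
  move=> t; apply: cvgM; first by apply: cvg_norm; exact: cv.
  apply: derivable_within_continuous => s _.
  apply: ex_derive.
have [s sa gs] := EVT_max a0 cg.
have vle t : t \in `[0, a] -> `|v t| <= g s * expR ((L + 1) * t).
  by move=> /gs; rewrite /g expRN ler_pdivrMr ?expR_gt0.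
have gs0 : 0 <= g s by rewrite mulr_ge0// expR_ge0.
have := @exp_growth _ _ v dv a (L * g s + M) (L + 1) l0 _ cv v0 hv.
have c0 : 0 <= L * g s + M by rewrite addr_ge0 ?mulr_ge0.
move=> /(_ c0) h.
have {}h : `|v s| <= (L * g s + M) / (L + 1) * expR ((L + 1) * s).
  apply: h => // t ta; rewrite (le_trans (hdv t ta))// mulrDl lerD//.
    by rewrite -mulrA ler_wpM2l// vle//; exact: subset_itv_oo_cc.
  have t0 : 0 <= t by move: ta; rewrite in_itv/= => /andP[/ltW].
  by rewrite ler_peMr// -[leLHS]expR0 ler_expR mulr_ge0// ltW.
have gsM : g s <= M.
  move: h; rewrite -ler_pdivrMr ?expR_gt0// -expRN -/(g s) ler_pdivlMr//.
  by rewrite mulrDr mulr1 mulrC lerD2l.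
by rewrite (le_trans (vle x xa))// ler_wpM2r// expR_ge0.
Qed.

End OneVariable.

(** * Fixed points and the Cauchy-Lipschitz theorem *)

Section Iteration.
Context {R : realType}.

Lemma halving_small (K e : R) : 0 < e -> exists k, K / 2 ^+ k < e.
Proof.
move=> e0; have [K0|K0] := leP K 0.
  by exists 0%N; rewrite expr0 divr1 (le_lt_trans K0).
have Ke0 : 0 <= K / e by rewrite divr_ge0// ltW.
exists (Num.bound (K / e)); rewrite ltr_pdivrMr ?exprn_gt0// mulrC -ltr_pdivrMr//.
rewrite (lt_le_trans (archi_boundP Ke0))// -natrX ler_nat ltnW//.
exact: ltn_expl.
Qed.

Lemma halving_le0 (a K : R) : (forall k, a <= K / 2 ^+ k) -> a <= 0.
Proof.
move=> h; rewrite leNgt; apply/negP => /(halving_small K)[k].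
by rewrite ltNge h.
Qed.

Lemma halving_limit_real (u : nat -> R) (C : R) :
  (forall k, `|u k.+1 - u k| <= C / 2 ^+ k) ->
  exists l, forall k, `|u k - l| <= 2 * C / 2 ^+ k.
Proof.
move=> hu.
(* The radius is the geometric tail, the sum of [C / 2 ^+ j] over [j >= k], which makes the
   intervals from [c k] to [b k] nested. The limit is their common point. *)
pose b k := u k + 2 * C / 2 ^+ k; pose c k := u k - 2 * C / 2 ^+ k.
have C2 k : C / 2 ^+ k = 2 * C / 2 ^+ k.+1.
  by rewrite exprS; field; rewrite expf_neq0.
have C3 k : 2 * C / 2 ^+ k = 2 * C / 2 ^+ k.+1 + 2 * C / 2 ^+ k.+1.
  by rewrite exprS; field; rewrite expf_neq0.
have bS k : b k.+1 <= b k.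
  by rewrite /b (C3 k); have := hu k; rewrite (C2 k) ler_norml; lra.
have cS k : c k <= c k.+1.
  by rewrite /c (C3 k); have := hu k; rewrite (C2 k) ler_norml; lra.
have bD k j : b (k + j)%N <= b k.
  by elim: j => [|j ih]; rewrite ?addn0// addnS (le_trans (bS _)).
have cD k j : c k <= c (k + j)%N.
  by elim: j => [|j ih]; rewrite ?addn0// addnS (le_trans ih).
have C0 : 0 <= C by have := le_trans (normr_ge0 _) (hu 0%N); rewrite divr1.
have cb k j : c k <= b j.
  rewrite (le_trans (cD k j))// addnC (le_trans _ (bD j k))//.
  rewrite /b /c lerD2l ge0_cp// divr_ge0// ?mulr_ge0// exprn_ge0//.
have cub j : ubound (range c) (b j) by move=> _ [k _ <-].
exists (sup (range c)) => k.
have cl : c k <= sup (range c).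
  by apply: ub_le_sup; [exists (b 0%N)|exists k].
have lb : sup (range c) <= b k by apply: ge_sup => //; exists (c 0%N), 0%N.
by move: cl lb; rewrite /b /c ler_norml; lra.
Qed.

Lemma halving_limit p q (u : nat -> 'M[R]_(p, q)) (C : R) :
  (forall k, `|u k.+1 - u k| <= C / 2 ^+ k) ->
  exists l, forall k, `|u k - l| <= 2 * C / 2 ^+ k.
Proof.
move=> hu.
have C0 : 0 <= C by have := le_trans (normr_ge0 _) (hu 0%N); rewrite divr1.
have h i j : exists l, forall k, `|u k i j - l| <= 2 * C / 2 ^+ k.
  apply: halving_limit_real => k; rewrite (le_trans _ (hu k))//.
  by have := mx_norm_entry (u k.+1 - u k) i j; rewrite !mxE.
pose l i j := sval (cid (h i j)).
exists (\matrix_(i, j) l i j) => k; apply/mx_norm_leP => [|i j].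
  by rewrite divr_ge0// ?mulr_ge0// exprn_ge0.
by rewrite !mxE /l; case: cid.
Qed.

(** [phi] inverts [w - f w]: for each [y] the map sending [w] to [f w + y] is a contraction of
    factor 1/2, and the constant 2 is [1 / (1 - 1/2)]. This plays the role of an implicit function
    theorem for the constraint on [f_I]. *)
Lemma lipschitz_perturbation_inverse p q (f : 'M[R]_(p, q) -> 'M[R]_(p, q)) :
  (forall a b, `|f a - f b| <= 2^-1 * `|a - b|) ->
  exists phi : 'M[R]_(p, q) -> 'M[R]_(p, q),
    [/\ forall y, phi y = f (phi y) + y,
        forall w y, w = f w + y -> w = phi y
      & forall y z, `|phi y - phi z| <= 2 * `|y - z|].
Proof.
move=> hf.
have ex y : exists w, w = f w + y.
  pose u k := iter k (fun w => f w + y) 0.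
  have hu k : `|u k.+1 - u k| <= `|u 1%N - u 0%N| / 2 ^+ k.
    elim: k => [|k ih]; first by rewrite divr1.
    have -> : u k.+2 - u k.+1 = f (u k.+1) - f (u k).
      by rewrite /u/= opprD addrACA subrr addr0.
    rewrite (le_trans (hf _ _))// (le_trans (ler_wpM2l _ ih))//.
    by rewrite exprS invfM mulrCA.
  have [l hl] := halving_limit hu; exists l.
  apply/eqP; rewrite -subr_eq0 -normr_le0; apply: halving_le0 => k.
  have -> : l - (f l + y) = (f (u k) - f l) - (u k.+1 - l).
    by apply/matrixP => i j; rewrite /u/= !mxE; ring.
  rewrite (le_trans (ler_normB _ _))// (le_trans (lerD (hf _ _) (hl _)))//.
  rewrite (le_trans (lerD (ler_wpM2l _ (hl k)) (lexx _)))//.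
  rewrite (_ : _ + _ = 2 * `|u 1%N - u 0%N| / 2 ^+ k)//.
  by rewrite exprS; field; rewrite expf_neq0.
pose phi y := sval (cid (ex y)).
have phiE y : phi y = f (phi y) + y by rewrite /phi; case: cid.
have lip w z y x : w = f w + y -> z = f z + x -> `|w - z| <= 2 * `|y - x|.
  move=> wE zE; have : `|w - z| <= 2^-1 * `|w - z| + `|y - x|.
    rewrite {1}wE {1}zE opprD addrACA (le_trans (ler_normD _ _))//.
    by rewrite lerD2r hf.
  by lra.
exists phi; split=> // [w y wE|y z]; last exact: lip.
have := lip _ _ _ _ wE (phiE y); rewrite subrr normr0 mulr0 normr_le0 subr_eq0.
by move/eqP.
Qed.

End Iteration.

Section Clamp.
Context {R : realType}.
Implicit Types a b x y : R.

(** For [a <= b], the projection onto the interval. It extends functions on [[0, 1]] continuously to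
    the line and, applied to each entry, retracts matrices onto a ball of the sup norm without
    increasing distances. *)
Definition clamp a b x := Num.max a (Num.min b x).

Lemma clamp_id a b x : a <= x -> x <= b -> clamp a b x = x.
Proof. by move=> ax xb; rewrite /clamp min_r// max_r. Qed.

Lemma clamp_itv a b x : a <= b -> a <= clamp a b x <= b.
Proof. by move=> ab; rewrite /clamp le_max lexx/= ge_max ab ge_min lexx. Qed.

Lemma clamp_lip a b x y : `|clamp a b x - clamp a b y| <= `|x - y|.
Proof.
have h1 := ler_norm (x - y).
have h2 : y - x <= `|x - y| by rewrite distrC ler_norm.
have m1 : `|Num.min b x - Num.min b y| <= `|x - y|.
  by rewrite ler_norml; case: (leP b x) => ?; case: (leP b y) => ?; lra.
rewrite (le_trans _ m1)// /clamp; move: (Num.min b x) (Num.min b y) => s t.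
have h3 := ler_norm (s - t).
have h4 : t - s <= `|s - t| by rewrite distrC ler_norm.
by rewrite ler_norml; case: (leP a s) => ?; case: (leP a t) => ?; lra.
Qed.

Lemma clamp_continuous a b : continuous (clamp a b).
Proof.
move=> x; apply/cvgrPdist_le => e e0; near=> t.
rewrite (le_trans (clamp_lip _ _ _ _))//; near: t.
Unshelve. all: by end_near. Qed.

Lemma continuous_clamp p q (g : R -> 'M[R]_(p, q)) a b : a <= b ->
  {within `[a, b], continuous g} -> continuous (g \o clamp a b).
Proof.
move=> ab /subspace_continuousP cg x.
have cx : `[a, b]%classic (clamp a b x) by rewrite /= in_itv/= clamp_itv.
apply: cvg_comp (cg _ cx).
move=> U; rewrite /within/= => hU.
have : \forall t \near x, `[a, b]%classic (clamp a b t) -> U (clamp a b t).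
  exact: (@clamp_continuous a b x _ hU).
apply: filterS => t; apply.
by rewrite /= in_itv/= clamp_itv.
Qed.

End Clamp.

(** * Antiderivatives and Picard iteration *)

Section Picard.
Context {R : realType}.

Lemma antiderivative_real (g : R -> R) : continuous g ->
  exists G : R -> R, forall x : R, x \in `[0, 1] -> is_derive x 1 G (g x).
Proof.
move=> cg.
(* Integrating from -1, with integrability up to 2, makes all of [[0, 1]] interior, so the
   derivative is two-sided at 0 and 1 as well. *)
exists (fun x => \int[@lebesgue_measure R]_(t in `[-1, x]) g t)%R => x.
rewrite in_itv/= => /andP[x0 x1].
have gi : (@lebesgue_measure R).-integrable `[-1, 2] (EFin \o g).
  apply: continuous_compact_integrable; first exact: segment_compact.
  exact: continuous_subspaceT.
have x2 : x < 2 by lra.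
have ax : -1 < x by lra.
have [d1 d2] := continuous_FTC1_closed x2 gi ax (cg x).
by split; [exact: d1|rewrite -derive1E; exact: d2].
Qed.

Lemma antiderivative p q (g : R -> 'M[R]_(p, q)) :
  {within `[0, 1], continuous g} ->
  exists G : R -> 'M[R]_(p, q),
    G 0 = 0 /\ forall x : R, x \in `[0, 1] -> is_derive x 1 G (g x).
Proof.
move=> /(continuous_clamp ler01) cg.
have h i j : exists G : R -> R,
    forall x : R, x \in `[0, 1] -> is_derive x 1 G (g x i j).
  have [|G hG] := @antiderivative_real (fun x => g (clamp 0 1 x) i j).
    by move=> x; have /cvg_mxP := cg x; exact.
  exists G => x x01; have := hG x x01.
  by move: x01; rewrite in_itv/= => /andP[x0 x1]; rewrite clamp_id.
pose G i j := sval (cid (h i j)).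
exists (fun x => \matrix_(i, j) (G i j x - G i j 0)); split.
  by apply/matrixP => i j; rewrite !mxE subrr.
move=> x x01; apply/is_derive_mxP => i j; under eq_fun do rewrite mxE.
have dG : is_derive x 1 (G i j) (g x i j).
  by rewrite /G; case: cid => /= ? /(_ x); exact.
by apply: (is_derive_eq (is_deriveB dG (is_derive_cst (G i j 0) x 1))); rewrite subr0.
Qed.

Lemma derive_within_continuous p q (v dv : R -> 'M[R]_(p, q)) a b :
  (forall x : R, x \in `[a, b] -> is_derive x 1 v (dv x)) ->
  {within `[a, b], continuous v}.
Proof.
by move=> h; apply: derivable_within_continuous => x xab; have [] := h x xab.
Qed.

Lemma lipschitz_comp_continuous {T : topologicalType} p q k l
    (F : 'M[R]_(p, q) -> 'M[R]_(k, l)) (L : R) (v : T -> 'M[R]_(p, q)) :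
  (forall a b, `|F a - F b| <= L * `|a - b|) ->
  continuous v -> continuous (F \o v).
Proof.
move=> hF cv x; apply/cvgrPdist_le => e e0.
have L0 : 0 < `|L| + 1 by rewrite ltr_wpDl.
have e1 : 0 < e / (`|L| + 1) by rewrite divr_gt0.
have /cvgrPdist_le/(_ _ e1) := cv x.
apply: filterS => t; rewrite ler_pdivlMr// => h.
rewrite (le_trans (hF _ _))// (le_trans _ h)// mulrC ler_wpM2l//.
by rewrite (le_trans (ler_norm L))// lerDl.
Qed.

(** Successive iterates are compared in the norm weighted by [expR (- (l * x))]. With
    [l = 2 * L + 1] each integration contracts by [L / l <= 1/2], so the iteration converges on the
    whole of [[0, 1]] however large [L] is. *)
Lemma picard p q (F : 'M[R]_(p, q) -> 'M[R]_(p, q)) (L : R) : 0 <= L ->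
  (forall a b, `|F a - F b| <= L * `|a - b|) ->
  exists v : R -> 'M[R]_(p, q),
    v 0 = 0 /\ forall x : R, x \in `[0, 1] -> is_derive x 1 v (F (v x)).
Proof.
move=> L0 hF.
(* Antidifferentiation is made a total operator so that it can be iterated; its value at a
   discontinuous [g] is arbitrary. *)
have ex (g : R -> 'M[R]_(p, q)) : exists G : R -> 'M[R]_(p, q),
    {within `[0, 1], continuous g} ->
    G 0 = 0 /\ forall x : R, x \in `[0, 1] -> is_derive x 1 G (g x).
  have [/antiderivative[G hG]|] := pselect {within `[0, 1], continuous g}.
    by exists G.
  by exists g.
have [I IP] := choice ex.
have cF (v : R -> 'M[R]_(p, q)) : {within `[0, 1], continuous v} ->
    {within `[0, 1], continuous (F \o v)}.
  by move=> cv; exact: (lipschitz_comp_continuous hF cv).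
have [u [uz uS]] : exists u : nat -> R -> 'M[R]_(p, q),
    u 0%N = (fun=> 0) /\ forall k, u k.+1 = I (F \o u k).
  by exists (fun k => iter k (fun v => I (F \o v)) (fun=> 0)).
have cu k : {within `[0, 1], continuous (u k)}.
  elim: k => [|k ih]; first by rewrite uz => x; exact: cvg_cst.
  by rewrite uS; have [_] := IP _ (cF _ ih); exact: derive_within_continuous.
have uP k : u k.+1 0 = 0 /\
    forall x : R, x \in `[0, 1] -> is_derive x 1 (u k.+1) (F (u k x)).
  by rewrite uS; exact: (IP _ (cF _ (cu k))).
have u0 k : u k 0 = 0 by case: k => [|k]; [rewrite uz|have [] := uP k].
have du1 k (x : R) : x \in `[0, 1] -> is_derive x 1 (u k.+1) (F (u k x)).
  by have [_] := uP k; exact.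
pose l : R := 2 * L + 1.
have l0 : 0 < l by rewrite /l; lra.
have Ll : L / l <= 2^-1 by rewrite ler_pdivrMr// /l; lra.
pose C := `|F 0| / l; have C0 : 0 <= C by rewrite divr_ge0// ltW.
have oo01 (x : R) : x \in `]0, 1[ -> x \in `[0, 1] by exact: subset_itv_oo_cc.
have du k (x : R) : x \in `[0, 1] ->
    `|u k.+1 x - u k x| <= C / 2 ^+ k * expR (l * x).
  elim: k x => [|k ih] x x01.
    rewrite uz subr0 divr1.
    have b (t : R) : t \in `]0, 1[ -> `|F (u 0%N t)| <= `|F 0| * expR (l * t).
      rewrite uz in_itv/= => /andP[t0 _].
      by rewrite ler_peMr// -[leLHS]expR0 ler_expR mulr_ge0// ltW.
    have d (t : R) (t01 : t \in `]0, 1[) := du1 0%N t (oo01 t t01).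
    exact: (exp_growth l0 (normr_ge0 _) (cu 1%N) (u0 1%N) d b x01).
  have cd : {within `[0, 1], continuous (fun t => u k.+2 t - u k.+1 t)}.
    by move=> t; apply: cvgB; [exact: (cu k.+2)|exact: (cu k.+1)].
  have d0 : u k.+2 0 - u k.+1 0 = 0 by rewrite !u0 subrr.
  have d (t : R) : t \in `]0, 1[ -> is_derive t 1
      (fun t => u k.+2 t - u k.+1 t) (F (u k.+1 t) - F (u k t)).
    by move=> /oo01 t01; exact: (is_deriveB (du1 k.+1 t t01) (du1 k t t01)).
  have b (t : R) : t \in `]0, 1[ ->
      `|F (u k.+1 t) - F (u k t)| <= L * (C / 2 ^+ k) * expR (l * t).
    move=> /oo01 t01; rewrite (le_trans (hF _ _))// -[leRHS]mulrA ler_wpM2l//.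
    exact: ih.
  have c0 : 0 <= L * (C / 2 ^+ k) by rewrite mulr_ge0// divr_ge0// exprn_ge0.
  rewrite (le_trans (exp_growth l0 c0 cd d0 d b x01))// ler_wpM2r ?expR_ge0//.
  by rewrite mulrAC exprS invfM [leRHS]mulrCA ler_wpM2r// divr_ge0// exprn_ge0.
pose C' := C * expR l.
have C'0 : 0 <= C' by rewrite mulr_ge0// expR_ge0.
have du' (x : R) k : x \in `[0, 1] -> `|u k.+1 x - u k x| <= C' / 2 ^+ k.
  move=> x01; rewrite (le_trans (du k x x01))// mulrAC ler_wpM2r ?invr_ge0 ?exprn_ge0//.
  have x1 : x <= 1 by move: x01; rewrite in_itv/= => /andP[].
  by rewrite ler_wpM2l// ler_expR ler_piMr// ltW.
have exw (x : R) : exists w, x \in `[0, 1] ->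
    forall k, `|u k x - w| <= 2 * C' / 2 ^+ k.
  have [x01|_] := boolP (x \in `[0, 1]); last by exists 0.
  by have [w hw] := halving_limit (fun k => du' x k x01); exists w.
have [w wE] := choice exw.
have wP (x : R) k : x \in `[0, 1] -> `|u k x - w x| <= 2 * C' / 2 ^+ k.
  by move=> x01; exact: wE.
have cw : {within `[0, 1], continuous w}.
  apply/subspace_continuousP => x x01; apply/cvgrPdist_le => e e0.
  have e3 : 0 < e / 3 by rewrite divr_gt0.
  have [k hk] := halving_small (2 * C') e3.
  have /subspace_continuousP/(_ x x01)/cvgrPdist_le/(_ _ e3) := cu k.
  apply: filterS2 (withinT _ _) => t/= t01 h.
  have -> : w x - w t = (w x - u k x) + (u k x - u k t) + (u k t - w t).
    by rewrite !subrKA.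
  have := wP x k x01; have := wP t k t01; rewrite [`|u k x - _|]distrC => h1 h2.
  have := ler_normD (w x - u k x + (u k x - u k t)) (u k t - w t).
  have := ler_normD (w x - u k x) (u k x - u k t).
  by move: h h1 h2 hk; lra.
have [G0 dG] := IP _ (cF _ cw).
(* The limit [w] is constrained on [[0, 1]] only, so it need not have two-sided derivatives at the
   ends. The antiderivative of [F \o w] has them, and it equals [w] on [[0, 1]]. *)
exists (I (F \o w)); split=> // x x01.
suff -> : I (F \o w) x = w x by exact: dG.
apply/eqP; rewrite -subr_eq0 -normr_le0.
apply: (halving_le0 (K := 2 * C' * (L / l * expR l) + C')) => k.
have cd : {within `[0, 1], continuous (fun t => I (F \o w) t - u k.+1 t)}.
  have cG := derive_within_continuous dG.
  by move=> t; apply: cvgB; [exact: cG|exact: (cu k.+1)].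
have d0 : I (F \o w) 0 - u k.+1 0 = 0 by rewrite G0 u0 subrr.
have d (t : R) : t \in `]0, 1[ -> is_derive t 1
    (fun t => I (F \o w) t - u k.+1 t) (F (w t) - F (u k t)).
  by move=> /oo01 t01; exact: (is_deriveB (dG t t01) (du1 k t t01)).
have c0 : 0 <= L * (2 * C' / 2 ^+ k).
  by rewrite mulr_ge0// divr_ge0 ?exprn_ge0// mulr_ge0.
have b (t : R) : t \in `]0, 1[ ->
    `|F (w t) - F (u k t)| <= L * (2 * C' / 2 ^+ k) * expR (l * t).
  move=> /oo01 t01; rewrite (le_trans (hF _ _))//.
  rewrite (@le_trans _ _ (L * (2 * C' / 2 ^+ k)))//.
    by rewrite ler_wpM2l// distrC wP.
  have t0 : 0 <= t by move: t01; rewrite in_itv/= => /andP[].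
  by rewrite ler_peMr// -[leLHS]expR0 ler_expR mulr_ge0// ltW.
have h := exp_growth l0 c0 cd d0 d b x01.
have h2 := wP x k.+1 x01.
rewrite -(subrKA (u k.+1 x)) (le_trans (ler_normD _ _))//.
rewrite (le_trans (lerD h h2))//.
have -> : 2 * C' / 2 ^+ k.+1 = C' / 2 ^+ k.
  by rewrite exprS; field; rewrite expf_neq0.
rewrite [leRHS]mulrDl lerD2r.
rewrite (@le_trans _ _ (L * (2 * C' / 2 ^+ k) / l * expR l))//.
  rewrite ler_wpM2l//; first by rewrite divr_ge0// ltW.
  have x1 : x <= 1 by move: x01; rewrite in_itv/= => /andP[].
  by rewrite ler_expR ler_piMr// ltW.
by rewrite le_eqVlt; apply/orP; left; apply/eqP; ring.
Qed.

End Picard.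

(** * Differentiation in finite dimension *)

Section Differential.
Context {R : realType}.

Lemma cV_sum_delta n (v : 'cV[R]_n) : v = \sum_(j < n) v j 0 *: delta_mx j 0.
Proof.
by rewrite {1}[v]matrix_sum_delta; apply: eq_bigr => j _; rewrite big_ord1.
Qed.

Lemma diff_sum_delta n (W : normedModType R) (g : 'cV[R]_n -> W) x v :
  differentiable g x ->
  'd g x v = \sum_(j < n) v j 0 *: 'D_(delta_mx j 0) g x.
Proof.
move=> dg; rewrite {1}[v]cV_sum_delta linear_sum; apply: eq_bigr => j _.
by rewrite linearZ/= deriveE.
Qed.

Lemma diff_Jac n p (g : 'cV[R]_n -> 'cV[R]_p) x v :
  differentiable g x -> 'd g x v = Jac g x *m v.
Proof.
move=> dg; rewrite diff_sum_delta//; apply/matrixP => i k.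
rewrite !mxE summxE; apply: eq_bigr => j _.
by rewrite !mxE [k]ord1 mulrC.
Qed.

Lemma diff_drow n (h : 'cV[R]_n -> R) x v :
  differentiable h x -> 'd h x v = (drow h x *m v) 0 0.
Proof.
move=> dh; rewrite diff_sum_delta//; rewrite !mxE; apply: eq_bigr => j _.
by rewrite !mxE mulrC.
Qed.

Lemma is_derive_comp_diff (V W : normedModType R) (g : V -> W) (U : R -> V)
    (x : R) dU :
  is_derive x 1 U dU -> differentiable g (U x) ->
  is_derive x 1 (fun t => g (U t)) ('d g (U x) dU).
Proof.
move=> [Ux <-] dg; have dU' : differentiable U x by exact/derivable1_diffP.
have dc : differentiable (g \o U) x by exact: differentiable_comp.
split; first exact/derivable1_diffP.
by rewrite deriveE// diff_comp//= deriveE.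
Qed.

Lemma diff_dist n (W : normedModType R) (g : 'cV[R]_n -> W) x y v (e : R) :
  differentiable g x -> differentiable g y ->
  (forall j, `|'D_(delta_mx j 0) g x - 'D_(delta_mx j 0) g y| <= e) ->
  `|'d g y v - 'd g x v| <= n%:R * (`|v| * e).
Proof.
move=> dx dy De; have -> : 'd g y v - 'd g x v =
    \sum_(j < n) v j 0 *: ('D_(delta_mx j 0) g y - 'D_(delta_mx j 0) g x).
  apply: (etrans (congr2 (fun a b => a - b) (diff_sum_delta v dy)
    (diff_sum_delta v dx))).
  by rewrite -sumrB; apply: eq_bigr => j _; rewrite scalerBr.
rewrite (le_trans (ler_norm_sum _ _ _))//.
have -> : n%:R * (`|v| * e) = \sum_(j < n) `|v| * e.
  by rewrite sumr_const card_ord mulr_natl.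
apply: ler_sum => j _; rewrite normrZ ler_pM//.
  exact: mx_norm_entry.
by rewrite distrC.
Qed.

(** In the sup norm the scalar mean value theorem can be applied to each entry separately, with an
    intermediate point depending on the entry. *)
Lemma mean_value_le p q (v dv : R -> 'M[R]_(p, q)) (c : R) : 0 <= c ->
  (forall x : R, x \in `[0, 1] -> is_derive x 1 v (dv x)) ->
  (forall x : R, x \in `[0, 1] -> `|dv x| <= c) -> `|v 1 - v 0| <= c.
Proof.
move=> c0 hv hc; apply/mx_norm_leP => // i j; rewrite !mxE.
have di (t : R) : t \in `[0, 1] -> is_derive t 1 (fun t => v t i j) (dv t i j).
  by move=> /hv/is_derive_mxP.
have ci : {within `[0, 1], continuous (fun t => v t i j)}.
  by apply: derivable_within_continuous => t /di[].
have dio (t : R) : t \in `]0, 1[ -> is_derive t 1 (fun t => v t i j) (dv t i j).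
  by move=> /subset_itv_oo_cc/di.
have [t t01 ->] := MVT ltr01 dio ci.
rewrite subr0 mulr1 (le_trans (mx_norm_entry _ _ _))// hc//.
exact: subset_itv_oo_cc.
Qed.

Lemma is_derive_scale_cst p q (c : 'M[R]_(p, q)) (x : R) :
  is_derive x 1 (fun t => t *: c) c.
Proof.
apply/is_derive_mxP => i j; under eq_fun do rewrite mxE.
apply: (is_derive_eq (is_deriveM (is_derive_id x 1) (is_derive_cst (c i j) x 1))).
by rewrite /GRing.scale/= mulr0 add0r mulr1.
Qed.

(** Both points move: this form makes the nonlinear remainder a contraction near [x0], which
    differentiability at [x0] alone would not. It is the mean value inequality for [g - 'd g x0]
    along the segment from [b] to [a], where the partial derivatives are close to those at [x0]. *)
Lemma strict_differentiable n p q (A : set 'cV[R]_n)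
    (g : 'cV[R]_n -> 'M[R]_(p, q)) (x0 : 'cV[R]_n) (e : R) :
  open A -> smooth_on A g -> A x0 -> 0 < e ->
  exists2 d, 0 < d & forall a b, `|a - x0| <= d -> `|b - x0| <= d ->
    `|g a - g b - 'd g x0 (a - b)| <= e * `|a - b|.
Proof.
move=> oA sg Ax0 e0.
have dg y : A y -> differentiable g y by exact: (sg [::]).
(* Summing over the [n] partial derivatives costs a factor [n]; the successor covers [n = 0]. *)
have e1 : 0 < e / n.+1%:R by rewrite divr_gt0.
have near_x0 : \forall y \near x0, A y /\ forall j : 'I_n,
    `|'D_(delta_mx j 0) g x0 - 'D_(delta_mx j 0) g y| <= e / n.+1%:R.
  near=> y; split; first by near: y; exact: open_nbhs_nbhs.
  near: y; apply: filter_forall => j.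
  have /differentiable_continuous := sg [:: delta_mx j 0] _ Ax0.
  by move=> /cvgrPdist_le/(_ _ e1).
have /nbhs_normP[d/= d0 hd] := near_x0.
exists (d / 2) => [|a b ha hb]; first by rewrite divr_gt0.
pose y t := b + t *: (a - b).
have yd (t : R) : t \in `[0, 1] -> `|x0 - y t| < d.
  rewrite in_itv/= => /andP[t0 t1].
  have -> : x0 - y t = - ((1 - t) *: (b - x0) + t *: (a - x0)).
    by apply/matrixP => i j; rewrite /y !mxE; ring.
  rewrite normrN (le_lt_trans (ler_normD _ _))// !normrZ !ger0_norm ?subr_ge0//.
  have h1 : (1 - t) * `|b - x0| <= (1 - t) * (d / 2) by rewrite ler_wpM2l ?subr_ge0.
  have h2 : t * `|a - x0| <= t * (d / 2) by rewrite ler_wpM2l.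
  by lra.
have dy (t : R) : is_derive t 1 y (a - b).
  apply: (is_derive_eq (is_deriveD (is_derive_cst b t 1) (is_derive_scale_cst _ t))).
  by rewrite add0r.
pose D := 'd g x0 (a - b).
have dh (t : R) : t \in `[0, 1] ->
    is_derive t 1 (fun t => g (y t) - t *: D) ('d g (y t) (a - b) - D).
  move=> t01; have [Ay _] := hd _ (yd t t01).
  exact: (is_deriveB (is_derive_comp_diff (dy t) (dg _ Ay)) (is_derive_scale_cst D t)).
have bh (t : R) : t \in `[0, 1] -> `|'d g (y t) (a - b) - D| <= e * `|a - b|.
  move=> t01; have [Ay Dy] := hd _ (yd t t01).
  rewrite (le_trans (diff_dist (a - b) (dg _ Ax0) (dg _ Ay) Dy))//.
  rewrite mulrCA mulrC ler_wpM2r//.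
  by rewrite mulrCA ler_piMr ?(ltW e0)// ler_pdivrMr// mul1r ler_nat.
have := mean_value_le (mulr_ge0 (ltW e0) (normr_ge0 _)) dh bh.
rewrite /y scale1r !scale0r addr0 subr0 scale1r [b + _]addrC subrK.
by rewrite addrAC.
Unshelve. all: by end_near. Qed.

Lemma locally_lipschitz n p q (A : set 'cV[R]_n)
    (g : 'cV[R]_n -> 'M[R]_(p, q)) (x0 : 'cV[R]_n) :
  open A -> smooth_on A g -> A x0 ->
  exists K d, [/\ 0 <= K, 0 < d & forall a b, `|a - x0| <= d ->
    `|b - x0| <= d -> `|g a - g b| <= K * `|a - b|].
Proof.
move=> oA sg Ax0.
have dg : differentiable g x0 by exact: (sg [::]).
have [k k0 hk] := linear_lipschitz (diff_continuous dg).
have [d d0 hd] := strict_differentiable oA sg Ax0 ltr01.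
exists (1 + k), d; split => // [|a b ha hb]; first by rewrite addr_ge0// ltW.
rewrite -[g a - g b](subrK ('d g x0 (a - b))) (le_trans (ler_normD _ _))//.
by rewrite mulrDl lerD// hd.
Qed.

End Differential.

(** * Positive definite matrices *)

Section PositiveDefinite.
Context {R : realType}.

Lemma inj_unitmx (F : fieldType) n (M : 'M[F]_n) :
  (forall v : 'cV[F]_n, M *m v = 0 -> v = 0) -> M \in unitmx.
Proof.
move=> h; rewrite -unitmx_tr -row_free_unit -kermx_eq0.
apply/eqP/row_matrixP => i; rewrite row0; apply: (can_inj (@trmxK _ _ _)).
rewrite trmx0; apply: h; apply: (can_inj (@trmxK _ _ _)).
by rewrite trmx_mul !trmxK trmx0 -row_mul mulmx_ker row0.
Qed.

Lemma qformDr n (M N : 'M[R]_n) v : qform (M + N) v = qform M v + qform N v.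
Proof. by rewrite /qform mulmxDr mulmxDl mxE. Qed.

Lemma qform_tr n (M : 'M[R]_n) v : qform M^T v = qform M v.
Proof.
rewrite /qform; have -> : v^T *m M^T *m v = (v^T *m M *m v)^T.
  by rewrite !trmx_mul trmxK mulmxA.
by rewrite mxE.
Qed.

Lemma qform0 n (M : 'M[R]_n) : qform M 0 = 0.
Proof. by rewrite /qform mulmx0 mxE. Qed.

Lemma qformZ n (M : 'M[R]_n) a v : qform M (a *: v) = a ^+ 2 * qform M v.
Proof.
by rewrite /qform -scalemxAr [(a *: v)^T]linearZ/= -!scalemxAl !mxE mulrA expr2.
Qed.

Lemma qform_add n (M : 'M[R]_n) u v : symmx M ->
  qform M (u + v) = qform M u + 2 * (v^T *m M *m u) 0 0 + qform M v.
Proof.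
move=> sM; rewrite /qform [(u + v)^T]linearD/= !mulmxDl !mulmxDr.
have D (A B : 'M[R]_1) : (A + B) 0 0 = A 0 0 + B 0 0 by rewrite mxE.
rewrite !D; have -> : u^T *m M *m v = (v^T *m M *m u)^T.
  by rewrite !trmx_mul trmxK sM mulmxA.
by rewrite [_^T 0 0]mxE; ring.
Qed.

Lemma dot_eq0 n (v : 'cV[R]_n) : (v^T *m v) 0 0 = 0 -> v = 0.
Proof.
rewrite mxE => /eqP; rewrite psumr_eq0 => [/allP h|i _]; last first.
  by rewrite mxE -expr2 sqr_ge0.
apply/matrixP => i j; rewrite [j]ord1 mxE; apply/eqP.
by have := h i (mem_index_enum i); rewrite mxE -expr2 sqrf_eq0.
Qed.

(** With [y = G c], nonnegativity of the form at [c + t y] for all real [t] prevents its linear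
    coefficient, twice the squared length of [y], from being nonzero. *)
Lemma psd_kernel n (G : 'M[R]_n) (c : 'cV[R]_n) : symmx G ->
  (forall v, 0 <= qform G v) -> qform G c = 0 -> G *m c = 0.
Proof.
move=> sG G0 Gc; apply: dot_eq0.
set y := G *m c; set s := (y^T *m y) 0 0; set q := qform G y.
have q0 : 0 <= q by exact: G0.
have h t : 0 <= 2 * t * s + t ^+ 2 * q.
  have := G0 (c + t *: y); rewrite qform_add// Gc add0r qformZ.
  by rewrite [(t *: y)^T]linearZ/= -!scalemxAl mxE -mulmxA -/y mulrA.
(* The minimizer would be [- s / q]; the added 1 covers [q = 0] and still makes the quadratic
   negative unless [s = 0]. *)
have := h (- s / (q + 1)).
have q1 : 0 < q + 1 by lra.
have -> : 2 * (- s / (q + 1)) * s + (- s / (q + 1)) ^+ 2 * q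
  = - (s ^+ 2 * ((q + 2) / (q + 1) ^+ 2)) by field; rewrite gt_eqF.
rewrite oppr_ge0 pmulr_lle0 ?divr_gt0 ?exprn_gt0//; last lra.
by move=> s2; apply/eqP; rewrite -sqrf_eq0 eq_le s2 sqr_ge0.
Qed.

Lemma posdef_inj n (M : 'M[R]_n) (v : 'cV[R]_n) :
  (forall v : 'cV[R]_n, v != 0 -> 0 < qform M v) -> M *m v = 0 -> v = 0.
Proof.
move=> h Mv; apply/eqP; apply: contraT => /h.
by rewrite /qform -mulmxA Mv mulmx0 mxE ltxx.
Qed.

Lemma posdef_ge0 n (M : 'M[R]_n) (v : 'cV[R]_n) :
  (forall v : 'cV[R]_n, v != 0 -> 0 < qform M v) -> 0 <= qform M v.
Proof.
by move=> h; have [->|/h/ltW//] := eqVneq v 0; rewrite qform0.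
Qed.

(* A minimizer [c] of the Rayleigh quotient [qform (S A) / qform S], with value
   [mu], satisfies [S A c = mu S c], so [mu] is an eigenvalue of [A]. *)
Lemma posdef_mul_pos_eigenvalues n (S A : 'M[R]_n) :
  posdefmx S -> symmx (S *m A) -> pos_eigenvalues A -> posdefmx (S *m A).
Proof.
move=> [sS pS] sT ev; split=> // v v0; rewrite ltNge; apply/negP => qv.
set T := S *m A in sT qv *.
(* The sup-norm sphere serves as well as the Euclidean one: both forms are homogeneous of degree 2,
   so a minimum of their quotient on it is a minimum over all nonzero vectors. *)
pose K : set 'rV[R]_n := [set x | `|x| = 1].
have Kne0 x : K x -> x^T != 0.
  move=> Kx; apply/eqP => x0; have : `|x| = 1 := Kx.
  by rewrite -[x]trmxK x0 trmx0 normr0 => /eqP; rewrite eq_sym oner_eq0.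
have cK : compact K.
  apply: bounded_closed_compact.
    by exists 1; split=> // M M1 x /= ->; exact: ltW.
  have h : {in ~` (fun x : 'rV[R]_n => `|x|) @^-1` [set x | x = 1],
      continuous (fun x : 'rV[R]_n => `|x|)}.
    by move=> x _; exact: norm_continuous.
  exact: (preimage_closed h (@closed_eq _ 1)).
have vn0 : `|v^T| != 0.
  by rewrite normr_eq0; apply: contra v0 => /eqP h; rewrite -[v]trmxK h trmx0.
have Kv : K (`|v^T|^-1 *: v^T).
  by rewrite /K/= normrZ normfV normr_id mulVf.
have cq (M : 'M[R]_n) : continuous (fun x : 'rV[R]_n => qform M x^T).
  have -> : (fun x : 'rV[R]_n => qform M x^T) = (fun x => (x *m M *m x^T) 0 0).
    by apply/funext => x; rewrite /qform trmxK.
  move=> x; have hx : (fun y : 'rV[R]_n => y) @ x --> x by exact: cvg_id.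
  have h : (fun x : 'rV[R]_n => x *m M *m x^T) @ x --> x *m M *m x^T.
    exact: (cvg_mulmx (cvg_mulmx hx (cvg_cst M)) (cvg_trmx hx)).
  by have /cvg_mxP := h; exact.
pose f (x : 'rV[R]_n) := qform T x^T / qform S x^T.
have cf : {within K, continuous f}.
  apply/subspace_continuousP => x Kx; apply: cvg_within_filter.
  apply: cvgM; first exact: cq.
  by apply: cvgV; [rewrite gt_eqF// pS// Kne0|exact: cq].
have [c] := compact_EVT_min (ex_intro _ _ Kv) cK cf.
rewrite inE => Kc cmin.
set mu := f c.
have mu0 : mu <= 0.
  apply: (le_trans (cmin _ (mem_set Kv))).
  rewrite /f pmulr_lle0 ?invr_gt0 ?pS ?Kne0//.
  by rewrite linearZ/= trmxK qformZ pmulr_rle0// exprn_gt0// invr_gt0 lt0r vn0/=.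
have qG w : qform (T - mu *: S) w = qform T w - mu * qform S w.
  by rewrite /qform mulmxBr mulmxBl -scalemxAr -scalemxAl !mxE.
have sG : symmx (T - mu *: S) by rewrite /symmx linearB/= linearZ/= sT sS.
have Gc : (T - mu *: S) *m c^T = 0.
  apply: psd_kernel => // [w|]; last first.
    by rewrite qG /mu /f divfK ?subrr// gt_eqF// pS// Kne0.
  have [->|w0] := eqVneq w 0; first by rewrite qform0.
  have wn0 : `|w^T| != 0.
    by rewrite normr_eq0; apply: contra w0 => /eqP h; rewrite -[w]trmxK h trmx0.
  have Kw : K (`|w^T|^-1 *: w^T) by rewrite /K/= normrZ normfV normr_id mulVf.
  have := cmin _ (mem_set Kw); rewrite /f linearZ/= trmxK !qformZ -mulf_div.
  rewrite divff ?expf_neq0 ?invr_eq0// mul1r -/mu ler_pdivlMr ?pS// qG.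
  by rewrite subr_ge0.
have : eigenvalue (mxC A) (real_complex R mu).
  (* [eigenvalue] asks for a left eigenvector; transposing [S A c = mu S c] and using the symmetry
     of [S A] and [S] gives the row [c S]. *)
  apply/eigenvalueP; exists (mxC (c *m S)).
    rewrite /mxC -map_mxM -map_mxZ; congr map_mx.
    rewrite -mulmxA -/T; apply: (can_inj (@trmxK _ _ _)).
    rewrite trmx_mul sT linearZ/= trmx_mul sS.
    by apply/eqP; rewrite -subr_eq0 scalemxAl -mulmxBl Gc.
  apply/eqP => h; have /eqP := Kne0 _ Kc; apply.
  apply: (posdef_inj pS); apply: (can_inj (@trmxK _ _ _)).
  rewrite trmx_mul trmxK sS trmx0; apply/matrixP => i j.
  by move/matrixP : h => /(_ i j); rewrite !mxE => -[].
by move=> /ev[_] /=; rewrite ltNge mu0.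
Qed.

End PositiveDefinite.

(** * Bilinear forms along curves and on block vectors *)

Section BilinearForm.
Context {R : realType}.

Definition bform n (M : 'M[R]_n) (u v : 'cV[R]_n) : R := (u^T *m M *m v) 0 0.

Lemma qformE n (M : 'M[R]_n) v : qform M v = bform M v v.
Proof. by []. Qed.

Lemma bformDr n (M : 'M[R]_n) u v w : bform M u (v + w) = bform M u v + bform M u w.
Proof. by rewrite /bform mulmxDr mxE. Qed.

Lemma bformZr n (M : 'M[R]_n) u a v : bform M u (a *: v) = a * bform M u v.
Proof. by rewrite /bform -scalemxAr mxE. Qed.

Lemma bform0l n (M : 'M[R]_n) v : bform M 0 v = 0.
Proof. by rewrite /bform trmx0 !mul0mx mxE. Qed.

Lemma bform0r n (M : 'M[R]_n) v : bform M v 0 = 0.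
Proof. by rewrite /bform mulmx0 mxE. Qed.

Lemma bform_mulr n (N M : 'M[R]_n) u v : bform N u (M *m v) = bform (N *m M) u v.
Proof. by rewrite /bform !mulmxA. Qed.

Lemma bformC n (N : 'M[R]_n) u v : symmx N -> bform N u v = bform N v u.
Proof.
move=> sN; rewrite /bform; have -> : u^T *m N *m v = (v^T *m N *m u)^T.
  by rewrite !trmx_mul trmxK sN mulmxA.
by rewrite mxE.
Qed.

Lemma is_derive_bform n (M : 'M[R]_n) (u v : R -> 'cV[R]_n) (x : R) du dv :
  is_derive x 1 u du -> is_derive x 1 v dv ->
  is_derive x 1 (fun t => bform M (u t) (v t)) (bform M du (v x) + bform M (u x) dv).
Proof.
move=> hu hv.
have h := is_derive_mulmx (is_derive_mulmxr M (is_derive_trmx hu)) hv.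
have /is_derive_mxP/(_ 0 0) := h.
by rewrite [X in is_derive _ _ _ X]mxE.
Qed.

Lemma is_derive_qform n (M : 'M[R]_n) (u : R -> 'cV[R]_n) (x : R) du :
  symmx M -> is_derive x 1 u du ->
  is_derive x 1 (fun t => qform M (u t)) (2 * bform M (u x) du).
Proof.
move=> sM hu; apply: (is_derive_eq (is_derive_bform M hu hu)).
by rewrite [bform M du _]bformC//; ring.
Qed.

Lemma continuous_bform {T : topologicalType} n (M : 'M[R]_n)
    (u v : T -> 'cV[R]_n) :
  continuous u -> continuous v -> continuous (fun t => bform M (u t) (v t)).
Proof.
move=> cu cv x.
have h : (fun t => (u t)^T *m M *m v t) @ x --> (u x)^T *m M *m v x.
  exact: (cvg_mulmx (cvg_mulmx (cvg_trmx (cu x)) (cvg_cst M)) (cv x)).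
by have /cvg_mxP := h; exact.
Qed.

Lemma qform_symmetrized n (M : 'M[R]_n) v : qform (M + M^T) v = 2 * qform M v.
Proof. by rewrite qformDr qform_tr; ring. Qed.

Lemma symmetrized_posdef n (M : 'M[R]_n) : posdefmx (M + M^T) ->
  forall v : 'cV[R]_n, v != 0 -> 0 < qform M v.
Proof. by move=> [_ h] v /h; rewrite qform_symmetrized pmulr_rgt0. Qed.

Lemma within_continuous_comp {T U W : topologicalType} (A : set T)
    (f : T -> U) (g : U -> W) :
  {within A, continuous f} -> (forall x, A x -> {for f x, continuous g}) ->
  {within A, continuous (fun x => g (f x))}.
Proof.
move=> /subspace_continuousP cf cg; apply/subspace_continuousP => x Ax.
exact: cvg_comp (cf x Ax) (cg x Ax).
Qed.

End BilinearForm.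

Section BlockForm.
Context {R : realType} {r m : nat}.
Implicit Types (u : 'cV[R]_(r + m)).

Lemma mul_block_dr p (M : 'M[R]_m) (u : 'M[R]_(r + m, p)) :
  (block_mx 0 0 0 M : 'M[R]_(r + m)) *m u = col_mx 0 (M *m dsubmx u).
Proof.
by rewrite -{1}[u]vsubmxK mul_block_col !mul0mx !add0r.
Qed.

Lemma bform_block_diag (M : 'M[R]_r) (N : 'M[R]_m) u v :
  bform (block_mx M 0 0 N) u v =
  bform M (usubmx u) (usubmx v) + bform N (dsubmx u) (dsubmx v).
Proof.
rewrite /bform -{1}[u]vsubmxK -{1}[v]vsubmxK tr_col_mx mul_row_block mul_row_col.
by rewrite !mulmx0 addr0 add0r mxE.
Qed.

Lemma qform_block_col0 (M : 'M[R]_(r + m)) u : dsubmx u = 0 ->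
  qform M u = qform (ulsubmx M) (usubmx u).
Proof.
move=> u0; rewrite /qform -{1 2}[u]vsubmxK u0 -{1}[M]submxK.
rewrite tr_col_mx mul_row_block mul_row_col trmx0.
by rewrite !mul0mx mulmx0 !addr0.
Qed.

End BlockForm.

(** * Uniqueness of steady solutions *)

Section Steady.
Context {R : realType} {r m : nat} (s : system R r m).
Local Notation state := 'cV[R]_(r + m).

Lemma mul_B (U v : state) : B s U *m v = col_mx 0 (B22 s U *m dsubmx v).
Proof. exact: mul_block_dr. Qed.

Lemma B22_unit U : symmetrizable s -> states s U -> B22 s U \in unitmx.
Proof.
move=> [S11 [S22 [_ h]]] /h[_ _ /symmetrized_posdef pd]; apply: inj_unitmx => v Bv.
by apply: (posdef_inj pd); rewrite -mulmxA Bv mulmx0.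
Qed.

Lemma state_eq (U V : state) : fI_injective s -> states s U -> states s V ->
  dsubmx U = dsubmx V -> usubmx (flux s U) = usubmx (flux s V) -> U = V.
Proof.
move=> inj sU sV UV fUV; rewrite -[U]vsubmxK -[V]vsubmxK UV; congr col_mx.
apply: (inj (dsubmx V)); rewrite ?inE/= ?vsubmxK// -UV ?vsubmxK//.
Qed.

Lemma is_derive_drow n (eta : 'cV[R]_n -> R) (A : set 'cV[R]_n)
    (w : R -> 'cV[R]_n) (x : R) dw :
  smooth_on A eta -> A (w x) -> is_derive x 1 w dw ->
  is_derive x 1 (fun t => drow eta (w t)) (dw^T *m hessian eta (w x)).
Proof.
move=> se Aw hw; apply/is_derive_mxP => i j.
under eq_fun do rewrite mxE.
have dj : differentiable (fun y => 'D_(delta_mx j 0) eta y) (w x).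
  exact: (se [:: delta_mx j 0]).
apply: (is_derive_eq (is_derive_comp_diff hw dj)).
rewrite (ord1 i) diff_sum_delta// [RHS]mxE.
by apply: eq_bigr => k _; rewrite !mxE.
Qed.

(* Along a steady solution [q(w) - d eta(w) (f(U) - c)], with [w = f0 U] and
   [f(U) - B(U) U' = c], is nonincreasing by the entropy inequality, and takes
   the same value at both ends. *)
Lemma steady_solution_constant (U0 : state) (U : R -> state) :
  A0_structure s -> smooth_system s -> symmetrizable s ->
  has_convex_entropy s -> fI_injective s -> states s U0 ->
  steady_solution s U0 (dsubmx U0) U ->
  forall x : R, x \in `[0, 1] -> U x = U0.
Proof.
move=> A0s [sf0 sflux _] symm [eta [q [se sq hent]]] inj sU0 [sU cU ode Ux0 Ux1].
have oo01 (x : R) : x \in `]0, 1[ -> x \in `[0, 1] by exact: subset_itv_oo_cc.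
have i0 : (0 : R) \in `[0, 1] by rewrite in_itv/= lexx ler01.
have i1 : (1 : R) \in `[0, 1] by rewrite in_itv/= lexx ler01.
have df0 y : states s y -> differentiable (f0 s) y by exact: (sf0 [::]).
have dfl y : states s y -> differentiable (flux s) y by exact: (sflux [::]).
have hU (x : R) : x \in `]0, 1[ -> is_derive x 1 U (derive1 U x).
  by move=> /ode[dU _ _]; exact: is_derive_derive1.
have hf (x : R) : x \in `]0, 1[ ->
    is_derive x 1 (fun t => flux s (U t)) (A s (U x) *m derive1 U x).
  move=> x01; have sx := sU x (oo01 x x01).
  have := is_derive_comp_diff (hU x x01) (dfl _ sx).
  by rewrite diff_Jac//; exact: dfl.
pose BU y := B s (U y) *m derive1 U y.
have hB (x : R) : x \in `]0, 1[ -> is_derive x 1 BU (A s (U x) *m derive1 U x).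
  move=> x01; have [_ dB fB] := ode x x01.
  by rewrite -(is_derive1_val (hf x x01)) fB; exact: is_derive_derive1.
pose c := flux s (U 2^-1) - BU 2^-1.
have half : (2^-1 : R) \in `]0, 1[ by rewrite in_itv/=; lra.
have BUE (x : R) : x \in `]0, 1[ -> BU x = flux s (U x) - c.
  move=> x01; suff -> : c = flux s (U x) - BU x by rewrite subKr.
  have h0 (t : R) : t \in `]0, 1[ -> is_derive t 1 (fun t => flux s (U t) - BU t) 0.
    move=> t01; apply: (is_derive_eq (is_deriveB (hf t t01) (hB t t01))).
    by rewrite subrr.
  exact: derive0_cst_oo h0 _ _ half x01.
have cfl : {within `[0, 1], continuous (fun t => flux s (U t))}.
  apply: (within_continuous_comp cU) => x x01.
  by apply: differentiable_continuous; apply/dfl/sU.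
have fIE (x : R) : x \in `[0, 1] -> usubmx (flux s (U x)) = usubmx (flux s U0).
  have cI : {within `[0, 1], continuous (fun t => usubmx (flux s (U t)))}.
    by move=> t; apply: cvg_usubmx; exact: cfl.
  have dI (t : R) : t \in `]0, 1[ ->
      is_derive t 1 (fun t => usubmx (flux s (U t))) 0.
    move=> t01; have h1 := is_derive_usubmx (hf t t01).
    have h2 := is_derive_usubmx (hB t t01).
    have E : (fun y => usubmx (BU y)) = cst 0.
      by apply/funext => y; rewrite /BU mul_B col_mxKu.
    rewrite E in h2.
    have := is_derive1_val h2; rewrite derive1_cst => h3.
    by rewrite h3.
  by move=> x01; rewrite (derive0_cst cI dI x01) Ux0.
have U1E : U 1 = U0.
  by apply: (state_eq inj) => //; [exact: sU|exact: fIE].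
pose w t := f0 s (U t).
have hw (x : R) : x \in `]0, 1[ -> is_derive x 1 w (A0 s (U x) *m derive1 U x).
  move=> x01; have sx := sU x (oo01 x x01).
  have := is_derive_comp_diff (hU x x01) (df0 _ sx).
  by rewrite diff_Jac//; exact: df0.
have sw (x : R) : x \in `[0, 1] -> (f0 s @` states s) (w x).
  by move=> x01; exists (U x) => //; exact: sU.
have cw : {within `[0, 1], continuous w}.
  apply: (within_continuous_comp cU) => x x01.
  by apply: differentiable_continuous; apply/df0/sU.
(* [flux s (U t) - c] stands for [BU t], which it equals inside the interval; unlike [BU] it is
   continuous up to 0 and 1. *)
pose e t := (drow eta (w t) *m (flux s (U t) - c)) 0 0 - q (w t).
pose M x := (A0 s (U x))^T *m hessian eta (w x) *m B s (U x).
have he (x : R) : x \in `]0, 1[ -> is_derive x 1 e (qform (M x) (derive1 U x)).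
  move=> x01; have sx := sU x (oo01 x x01).
  have h1 := is_derive_drow se (sw x (oo01 x x01)) (hw x x01).
  have h2 : is_derive x 1 (fun t => flux s (U t) - c) (A s (U x) *m derive1 U x).
    apply: (is_derive_eq (is_deriveB (hf x x01) (is_derive_cst c x 1))).
    by rewrite subr0.
  have /is_derive_mxP/(_ 0 0) h3 := is_derive_mulmx h1 h2.
  have dq : differentiable q (w x) by exact: (sq [::] _ (sw x (oo01 x x01))).
  have h4 := is_derive_comp_diff (hw x x01) dq.
  (* The compatibility relation between [eta] and [q] cancels the two first-order terms; what is
     left is the Hessian of [eta] paired with [f(U) - c = B(U) U']. *)
  apply: (is_derive_eq (is_deriveB h3 h4)).
  rewrite diff_drow// -/(w x).
  have [_ <- _ _] := hent _ sx.
  have [_ _ A0u _] := A0s _ sx.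
  rewrite -!mulmxA mulKmx// [X in X - _]mxE addrK.
  by rewrite -BUE// /BU /qform /M trmx_mul !mulmxA.
have ce : {within `[0, 1], continuous e}.
  have c1 : {within `[0, 1], continuous (fun t => drow eta (w t))}.
    apply: (within_continuous_comp cw) => x x01.
    apply: (cvg_mxP (F := nbhs (w x)) (drow eta) (drow eta (w x))).2 => i j.
    under eq_fun do rewrite mxE.
    rewrite mxE.
    exact: (differentiable_continuous (se [:: delta_mx j 0] _ (sw x x01))).
  have c2 : {within `[0, 1], continuous (fun t => flux s (U t) - c)}.
    by move=> t; apply: cvgB; [exact: cfl|exact: cvg_cst].
  have c3 : {within `[0, 1], continuous (fun t => q (w t))}.
    apply: (within_continuous_comp cw) => x x01.
    by apply: differentiable_continuous; exact: (sq [::] _ (sw x x01)).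
  have c4 : {within `[0, 1], continuous
      (fun t => drow eta (w t) *m (flux s (U t) - c))}.
    by move=> t; exact: (cvg_mulmx (c1 t) (c2 t)).
  have c5 : {within `[0, 1], continuous
      (fun t => (drow eta (w t) *m (flux s (U t) - c)) 0 0)}.
    by move=> t; have /cvg_mxP := c4 t; exact.
  by move=> t; apply: cvgB; [exact: c5|exact: c3].
have M0 (x : R) : x \in `]0, 1[ -> 0 <= qform (M x) (derive1 U x).
  move=> x01; have [_ _ + _] := hent _ (sU x (oo01 x x01)).
  by move=> /(_ (derive1 U x)); rewrite qform_symmetrized pmulr_rge0.
have e01 : e 1 <= e 0 by rewrite /e /w U1E Ux0.
have [qM _] := derive_ge0_eq0 ltr01 ce he M0 e01.
have dII (x : R) : x \in `]0, 1[ -> is_derive x 1 (fun t => dsubmx (U t)) 0.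
  move=> x01; have sx := sU x (oo01 x x01).
  have [_ _ _ /(_ (derive1 U x))] := hent _ sx.
  rewrite qform_symmetrized -/(w x) -/(M x) qM// mulr0 => /(_ erefl).
  rewrite mul_B => /eqP; rewrite col_mx_eq0 => /andP[_ /eqP BU0].
  have d0 : dsubmx (derive1 U x) = 0.
    by rewrite -[LHS](mulKmx (B22_unit symm sx)) BU0 mulmx0.
  by have := is_derive_dsubmx (hU x x01); rewrite d0.
have cII : {within `[0, 1], continuous (fun t => dsubmx (U t))}.
  by move=> t; apply: cvg_dsubmx; exact: cU.
move=> x x01; apply: (state_eq inj) => //; [exact: sU| |exact: fIE].
by rewrite (derive0_cst cII dII x01) Ux0.
Qed.

End Steady.

(** * Spectral stability *)

Section Spectral.
Context {R : realType}.

Section RealEigensystem.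
Context {r m : nat}.
Variables (A0 A : 'M[R]_(r + m)) (B22 : 'M[R]_m) (S11 : 'M[R]_r) (S22 : 'M[R]_m).
Let S : 'M[R]_(r + m) := block_mx S11 0 0 S22.
Let B : 'M[R]_(r + m) := block_mx 0 0 0 B22.
Hypothesis A0u : ulsubmx A0 = 1%:M.
Hypothesis A0r : ursubmx A0 = 0.
Hypothesis SA0 : posdefmx (S *m A0).
Hypothesis SA : symmx (S *m A).
Hypothesis S22B22 : posdefmx (S22 *m B22 + (S22 *m B22)^T).
Hypothesis evA : pos_eigenvalues (ulsubmx A).

Let A11 := ulsubmx A.

Lemma usubmx_A0 p (v : 'M[R]_(r + m, p)) : usubmx (A0 *m v) = usubmx v.
Proof.
rewrite -{1}[A0]submxK A0u A0r -{1}[v]vsubmxK mul_block_col col_mxKu.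
by rewrite mul1mx mul0mx addr0.
Qed.

Lemma usubmx_A p (v : 'M[R]_(r + m, p)) :
  usubmx (A *m v) = A11 *m usubmx v + ursubmx A *m dsubmx v.
Proof. by rewrite -{1}[A]submxK -{1}[v]vsubmxK mul_block_col col_mxKu. Qed.

(** The first block row of [A0] is the identity followed by zero, which makes [S11] the leading
    block of [S A0]. *)
Lemma S11_posdef : posdefmx S11.
Proof.
have SA0u : ulsubmx (S *m A0) = S11.
  by rewrite -{1}[A0]submxK A0u A0r mulmx_block block_mxKul mulmx1 mul0mx addr0.
have [sym pd] := SA0; split=> [|v v0].
  by rewrite /symmx -SA0u trmx_ulsub sym.
have := pd (col_mx v 0); rewrite qform_block_col0 ?col_mxKd// SA0u col_mxKu.
by apply; rewrite col_mx_eq0 negb_and v0.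
Qed.

(** [S11 A11] is the leading block of [S A], hence symmetric; the positive eigenvalues of [A11] turn
    symmetry into positivity. The result also yields the invertibility of [A11] in the shooting
    problem. *)
Lemma S11A11_posdef : posdefmx (S11 *m A11).
Proof.
apply: posdef_mul_pos_eigenvalues => //; first exact: S11_posdef.
have SAu : ulsubmx (S *m A) = S11 *m A11.
  by rewrite -{1}[A]submxK mulmx_block block_mxKul mul0mx addr0.
by rewrite /symmx -SAu trmx_ulsub SA.
Qed.

Lemma qform_SB v : qform (S *m B) v = qform (S22 *m B22) (dsubmx v).
Proof.
rewrite /S /B mulmx_block !mulmx0 !mul0mx !addr0 add0r.
by rewrite !qformE bform_block_diag /bform mulmx0 mul0mx mxE add0r.
Qed.

Lemma qform_SB_ge0 v : 0 <= qform (S *m B) v.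
Proof. by rewrite qform_SB; apply: posdef_ge0; exact: symmetrized_posdef. Qed.

Lemma qform_SB_eq0 v : qform (S *m B) v = 0 -> dsubmx v = 0.
Proof.
rewrite qform_SB => h; apply/eqP; apply: contraT => /(symmetrized_posdef S22B22).
by rewrite h ltxx.
Qed.

(* [e] below is the energy balance of the real and imaginary parts [a], [b];
   [Fa], [Fb] extend [B a'], [B b'] continuously up to the boundary. *)
Lemma real_eigensystem_trivial (al be : R) (a b da db : R -> 'cV[R]_(r + m)) :
  0 <= al ->
  {within `[0, 1], continuous a} -> {within `[0, 1], continuous b} ->
  (forall x : R, x \in `]0, 1[ -> is_derive x 1 a (da x)) ->
  (forall x : R, x \in `]0, 1[ -> is_derive x 1 b (db x)) ->
  (forall x : R, x \in `]0, 1[ -> is_derive x 1 (fun t => B *m da t)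
     ((al *: (A0 *m a x) - be *: (A0 *m b x)) + A *m da x)) ->
  (forall x : R, x \in `]0, 1[ -> is_derive x 1 (fun t => B *m db t)
     ((al *: (A0 *m b x) + be *: (A0 *m a x)) + A *m db x)) ->
  a 0 = 0 -> b 0 = 0 -> dsubmx (a 1) = 0 -> dsubmx (b 1) = 0 ->
  forall x : R, x \in `[0, 1] -> a x = 0 /\ b x = 0.
Proof.
move=> al0 ca cb ha hb hBa hBb a0 b0 a1 b1.
have oo01 (x : R) : x \in `]0, 1[ -> x \in `[0, 1] by exact: subset_itv_oo_cc.
have i0 : (0 : R) \in `[0, 1] by rewrite in_itv/= lexx ler01.
have i1 : (1 : R) \in `[0, 1] by rewrite in_itv/= lexx ler01.
have half : (2^-1 : R) \in `]0, 1[ by rewrite in_itv/=; lra.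
have flux_ext (u du ga : R -> 'cV[R]_(r + m)) :
    {within `[0, 1], continuous u} -> {within `[0, 1], continuous ga} ->
    (forall x : R, x \in `]0, 1[ -> is_derive x 1 u (du x)) ->
    (forall x : R, x \in `]0, 1[ ->
      is_derive x 1 (fun t => B *m du t) (ga x + A *m du x)) ->
    exists F : R -> 'cV[R]_(r + m),
      [/\ {within `[0, 1], continuous F},
          forall x : R, x \in `]0, 1[ -> F x = B *m du x,
          forall x : R, x \in `]0, 1[ -> is_derive x 1 F (ga x + A *m du x)
        & forall x : R, x \in `[0, 1] -> usubmx (F x) = 0].
  move=> cu cga hu hBu.
  have [G [_ hG]] := antiderivative cga.
  (* Inside the interval [F0] and [B u'] have the same derivative, so they differ by the constant
     [c]; [F0] is continuous on the closed interval. The zero rows of [B] make the first block of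
     [F0 + c] vanish inside, hence also at the ends. *)
  pose F0 t := G t + A *m u t.
  have hF0 (x : R) : x \in `]0, 1[ -> is_derive x 1 F0 (ga x + A *m du x).
    move=> x01.
    exact: (is_deriveD (hG x (oo01 x x01)) (is_derive_mulmxl A (hu x x01))).
  have cF0 : {within `[0, 1], continuous F0}.
    have cG := derive_within_continuous hG.
    move=> t; apply: cvgD; first exact: cG.
    exact: (cvg_mulmx (cvg_cst A) (cu t)).
  pose c := B *m du 2^-1 - F0 2^-1.
  have FE (x : R) : x \in `]0, 1[ -> F0 x + c = B *m du x.
    move=> x01; suff -> : c = B *m du x - F0 x by rewrite addrC subrK.
    have h0 (t : R) : t \in `]0, 1[ -> is_derive t 1 (fun t => B *m du t - F0 t) 0.
      move=> t01; apply: (is_derive_eq (is_deriveB (hBu t t01) (hF0 t t01))).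
      by rewrite subrr.
    exact: derive0_cst_oo h0 _ _ half x01.
  have hF (x : R) : x \in `]0, 1[ ->
      is_derive x 1 (fun t => F0 t + c) (ga x + A *m du x).
    move=> x01; apply: (is_derive_eq (is_deriveD (hF0 x x01) (is_derive_cst c x 1))).
    by rewrite addr0.
  have cF : {within `[0, 1], continuous (fun t => F0 t + c)}.
    by move=> t; apply: cvgD; [exact: cF0|exact: cvg_cst].
  exists (fun t => F0 t + c); split=> //.
  have cFu : {within `[0, 1], continuous (fun t => usubmx (F0 t + c))}.
    by move=> t; apply: cvg_usubmx; exact: cF.
  have FuE (x : R) : x \in `]0, 1[ -> usubmx (F0 x + c) = 0.
    by move=> x01; rewrite FE// mul_block_dr col_mxKu.
  have dFu (x : R) : x \in `]0, 1[ -> is_derive x 1 (fun t => usubmx (F0 t + c)) 0.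
    move=> x01; apply: (is_derive_near (f := cst 0) x01) => t t01.
    by rewrite FuE.
  move=> x x01; rewrite (derive0_cst cFu dFu x01).
  by rewrite -(derive0_cst cFu dFu (oo01 _ half)) FuE.
have cA0 (u : R -> 'cV[R]_(r + m)) k : {within `[0, 1], continuous u} ->
    {within `[0, 1], continuous (fun t => k *: (A0 *m u t))}.
  by move=> cu t; apply: cvgZr; exact: (cvg_mulmx (cvg_cst A0) (cu t)).
have cga : {within `[0, 1],
    continuous (fun t => al *: (A0 *m a t) - be *: (A0 *m b t))}.
  by move=> t; apply: cvgB; [exact: (cA0 a al ca)|exact: (cA0 b be cb)].
have cgb : {within `[0, 1],
    continuous (fun t => al *: (A0 *m b t) + be *: (A0 *m a t))}.
  by move=> t; apply: cvgD; [exact: (cA0 b al cb)|exact: (cA0 a be ca)].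
have [Fa [cFa FaE hFa Fau]] := flux_ext _ _ _ ca cga ha hBa.
have [Fb [cFb FbE hFb Fbu]] := flux_ext _ _ _ cb cgb hb hBb.
have [SA0s SA0p] := SA0.
pose e t := bform S (a t) (Fa t) + bform S (b t) (Fb t)
  - 2^-1 * (qform (S *m A) (a t) + qform (S *m A) (b t)).
pose de x := qform (S *m B) (da x) + qform (S *m B) (db x)
  + al * (qform (S *m A0) (a x) + qform (S *m A0) (b x)).
have he (x : R) : x \in `]0, 1[ -> is_derive x 1 e (de x).
  move=> x01.
  have h1 := is_derive_bform S (ha x x01) (hFa x x01).
  have h2 := is_derive_bform S (hb x x01) (hFb x x01).
  have h3 := is_derive_qform SA (ha x x01).
  have h4 := is_derive_qform SA (hb x x01).
  apply: (is_derive_eq (is_deriveB (is_deriveD h1 h2)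
    (is_deriveZ 2^-1 (is_deriveD h3 h4)))).
  (* Symmetry of [S A] makes the terms in [A] cancel against the derivative of the last part of [e];
     symmetry of [S A0] cancels the cross terms in [be] between [a] and [b]. *)
  rewrite FaE// FbE// /de -!scaleNr.
  rewrite !bformDr !bformZr !bform_mulr -!qformE.
  by rewrite [bform (S *m A0) (b x) (a x)]bformC// /GRing.scale/=; field.
have ce : {within `[0, 1], continuous e}.
  have c1 := continuous_bform (M := S) ca cFa.
  have c2 := continuous_bform (M := S) cb cFb.
  have c3 := continuous_bform (M := S *m A) ca ca.
  have c4 := continuous_bform (M := S *m A) cb cb.
  move=> t; apply: cvgB; first by apply: cvgD; [exact: c1|exact: c2].
  by apply: cvgM; [exact: cvg_cst|apply: cvgD; [exact: c3|exact: c4]].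
have de0 (x : R) : x \in `]0, 1[ -> 0 <= de x.
  move=> _; rewrite /de !addr_ge0 ?qform_SB_ge0// mulr_ge0// addr_ge0//;
    exact: posdef_ge0.
(* At 1 the pairings with [Fa] and [Fb] vanish, since [S] is block diagonal, the first blocks of
   [Fa] and [Fb] are zero and so are the second blocks of [a] and [b]. Only minus half the [S11 A11]
   form remains, while [e 0 = 0]. *)
have e01 : e 1 <= e 0.
  rewrite /e a0 b0 !bform0l !qform0 !addr0 mulr0 subr0.
  rewrite !bform_block_diag Fau// Fbu// a1 b1 !bform0r !bform0l !addr0 sub0r.
  rewrite oppr_le0 mulr_ge0// ?invr_ge0//.
  rewrite !qform_block_col0// -{1 2}[A]submxK mulmx_block block_mxKul mul0mx addr0.
  have [_ p] := S11A11_posdef.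
  by rewrite addr_ge0//; exact: posdef_ge0.
have [deE _] := derive_ge0_eq0 ltr01 ce he de0 e01.
have dd0 (x : R) : x \in `]0, 1[ -> dsubmx (da x) = 0 /\ dsubmx (db x) = 0.
  move=> x01; have := deE x x01; rewrite /de.
  have := qform_SB_ge0 (da x); have := qform_SB_ge0 (db x).
  have : 0 <= al * (qform (S *m A0) (a x) + qform (S *m A0) (b x)).
    by rewrite mulr_ge0// addr_ge0//; exact: posdef_ge0.
  by move=> h1 h2 h3 h4; split; apply: qform_SB_eq0; lra.
have dII (u du : R -> 'cV[R]_(r + m)) : {within `[0, 1], continuous u} ->
    (forall x : R, x \in `]0, 1[ -> is_derive x 1 u (du x)) -> u 0 = 0 ->
    (forall x : R, x \in `]0, 1[ -> dsubmx (du x) = 0) ->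
    forall x : R, x \in `[0, 1] -> dsubmx (u x) = 0.
  move=> cu hu u0 du0 x x01.
  have cII : {within `[0, 1], continuous (fun t => dsubmx (u t))}.
    by move=> t; apply: cvg_dsubmx; exact: cu.
  have hII (t : R) : t \in `]0, 1[ -> is_derive t 1 (fun t => dsubmx (u t)) 0.
    by move=> t01; have := is_derive_dsubmx (hu t t01); rewrite du0.
  by rewrite (derive0_cst cII hII x01) u0 linear0.
have aII := dII a da ca ha a0 (fun x x01 => (dd0 x x01).1).
have bII := dII b db cb hb b0 (fun x x01 => (dd0 x x01).2).
have hI (ga : R -> 'cV[R]_(r + m)) (du : R -> 'cV[R]_(r + m)) :
    (forall x : R, x \in `]0, 1[ ->
      is_derive x 1 (fun t => B *m du t) (ga x + A *m du x)) ->
    (forall x : R, x \in `]0, 1[ -> dsubmx (du x) = 0) ->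
    forall x : R, x \in `]0, 1[ -> A11 *m usubmx (du x) = - usubmx (ga x).
  move=> hBu du0 x x01.
  have h0 : is_derive x 1 (fun t => B *m du t) 0.
    apply: (is_derive_near (f := cst 0) x01) => t t01.
    by rewrite mul_block_dr du0// mulmx0 col_mx0.
  have := is_derive1_val (hBu x x01); rewrite (is_derive1_val h0).
  move=> /(congr1 usubmx)/esym; rewrite linear0 linearD/= usubmx_A du0//.
  by rewrite mulmx0 addr0 => /eqP; rewrite addrC addr_eq0 => /eqP.
have usubZ k (u : 'cV[R]_(r + m)) : usubmx (k *: (A0 *m u)) = k *: usubmx u.
  by rewrite linearZ/= usubmx_A0.
have aI (x : R) : x \in `]0, 1[ ->
    A11 *m usubmx (da x) = (- al) *: usubmx (a x) + be *: usubmx (b x).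
  move=> x01; rewrite (hI _ _ hBa (fun x x01 => (dd0 x x01).1) x x01).
  by rewrite linearB/= !usubZ scaleNr opprB addrC.
have bI (x : R) : x \in `]0, 1[ ->
    A11 *m usubmx (db x) = (- al) *: usubmx (b x) + (- be) *: usubmx (a x).
  move=> x01; rewrite (hI _ _ hBb (fun x x01 => (dd0 x x01).2) x x01).
  by rewrite linearD/= !usubZ !scaleNr opprD.
have [T_sym T_pos] := S11A11_posdef.
have [S11s S11p] := S11_posdef.
(* When [al = 0], [de = 0] says nothing about the first blocks. They now satisfy the transport
   equation [A11 u' = - lambda u] with zero data at 0, for which [- g] is a nonincreasing energy. *)
pose g t := - (qform (S11 *m A11) (usubmx (a t)) + qform (S11 *m A11) (usubmx (b t))).
pose dg x := 2 * al * (qform S11 (usubmx (a x)) + qform S11 (usubmx (b x))).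
have hg (x : R) : x \in `]0, 1[ -> is_derive x 1 g (dg x).
  move=> x01.
  have h1 := is_derive_qform T_sym (is_derive_usubmx (ha x x01)).
  have h2 := is_derive_qform T_sym (is_derive_usubmx (hb x x01)).
  apply: (is_derive_eq (is_deriveN (is_deriveD h1 h2))).
  rewrite -!bform_mulr aI// bI// !bformDr !bformZr /dg !qformE.
  by rewrite [bform S11 (usubmx (b x)) (usubmx (a x))]bformC//; ring.
have cg : {within `[0, 1], continuous g}.
  have cua : {within `[0, 1], continuous (fun t => usubmx (a t))}.
    by move=> t; apply: cvg_usubmx; exact: ca.
  have cub : {within `[0, 1], continuous (fun t => usubmx (b t))}.
    by move=> t; apply: cvg_usubmx; exact: cb.
  have c1 := continuous_bform (M := S11 *m A11) cua cua.
  have c2 := continuous_bform (M := S11 *m A11) cub cub.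
  by move=> t; apply: cvgN; apply: cvgD; [exact: c1|exact: c2].
have dg0 (x : R) : x \in `]0, 1[ -> 0 <= dg x.
  by move=> _; rewrite /dg mulr_ge0 ?mulr_ge0// addr_ge0//; exact: posdef_ge0.
move=> x x01; have : g 0 <= g x.
  move: x01; rewrite in_itv/= => /andP[x0 x1].
  exact: derive_ge0_le cg hg dg0 _ _ (lexx _) x0 x1.
rewrite /g a0 b0 !linear0 !qform0 addr0 oppr0 oppr_ge0.
have := posdef_ge0 (usubmx (a x)) T_pos; have := posdef_ge0 (usubmx (b x)) T_pos.
have z0 (u : 'cV[R]_r) : qform (S11 *m A11) u <= 0 -> u = 0.
  by move=> h; apply/eqP; apply: contraT => /T_pos; rewrite ltNge h.
move=> h1 h2 h3.
have au : usubmx (a x) = 0 by apply: z0; lra.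
have bu : usubmx (b x) = 0 by apply: z0; lra.
split; first by rewrite -[a x]vsubmxK au aII// col_mx0.
by rewrite -[b x]vsubmxK bu bII// col_mx0.
Qed.

End RealEigensystem.

(** * Real and imaginary parts of the eigenvalue problem *)

Lemma mxReD n p (X Y : 'M[R[i]]_(n, p)) : mxRe (X + Y) = mxRe X + mxRe Y.
Proof. by apply/matrixP => i j; rewrite !mxE; case: (X i j) (Y i j) => [? ?] []. Qed.

Lemma mxImD n p (X Y : 'M[R[i]]_(n, p)) : mxIm (X + Y) = mxIm X + mxIm Y.
Proof. by apply/matrixP => i j; rewrite !mxE; case: (X i j) (Y i j) => [? ?] []. Qed.

Lemma mxReZ n p (l : R[i]) (X : 'M[R[i]]_(n, p)) :
  mxRe (l *: X) = complex.Re l *: mxRe X - complex.Im l *: mxIm X.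
Proof.
by apply/matrixP => i j; rewrite !mxE; case: l (X i j) => [? ?] [? ?].
Qed.

Lemma mxImZ n p (l : R[i]) (X : 'M[R[i]]_(n, p)) :
  mxIm (l *: X) = complex.Re l *: mxIm X + complex.Im l *: mxRe X.
Proof.
by apply/matrixP => i j; rewrite !mxE; case: l (X i j) => [? ?] [? ?].
Qed.

Lemma mxRe_scale_add n p (l : R[i]) (W X Y : 'M[R[i]]_(n, p)) : l *: W + X = Y ->
  complex.Re l *: mxRe W - complex.Im l *: mxIm W + mxRe X = mxRe Y.
Proof. by move=> <-; rewrite mxReD mxReZ. Qed.

Lemma mxIm_scale_add n p (l : R[i]) (W X Y : 'M[R[i]]_(n, p)) : l *: W + X = Y ->
  complex.Re l *: mxIm W + complex.Im l *: mxRe W + mxIm X = mxIm Y.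
Proof. by move=> <-; rewrite mxImD mxImZ. Qed.

Lemma mxRe_mulC n p q (M : 'M[R]_(n, p)) (X : 'M[R[i]]_(p, q)) :
  mxRe (mxC M *m X) = M *m mxRe X.
Proof.
apply/matrixP => i j; rewrite !mxE raddf_sum; apply: eq_bigr => k _.
by rewrite !mxE; case: (X k j) => u v /=; rewrite mul0r subr0.
Qed.

Lemma mxIm_mulC n p q (M : 'M[R]_(n, p)) (X : 'M[R[i]]_(p, q)) :
  mxIm (mxC M *m X) = M *m mxIm X.
Proof.
apply/matrixP => i j; rewrite !mxE raddf_sum; apply: eq_bigr => k _.
by rewrite !mxE; case: (X k j) => u v /=; rewrite mul0r addr0.
Qed.

Lemma mxRe_cderive1 n (V : R -> 'cV[R[i]]_n) (x : R) :
  mxRe (cderive1 V x) = derive1 (fun y => mxRe (V y)) x.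
Proof.
rewrite /cderive1; set X := derive1 _ _; set Y := derive1 _ _.
by apply/matrixP => i j; rewrite !mxE/= !mul0r mul1r subr0 addr0.
Qed.

Lemma mxIm_cderive1 n (V : R -> 'cV[R[i]]_n) (x : R) :
  mxIm (cderive1 V x) = derive1 (fun y => mxIm (V y)) x.
Proof.
rewrite /cderive1; set X := derive1 _ _; set Y := derive1 _ _.
by apply/matrixP => i j; rewrite !mxE/= !mul0r mul1r !add0r.
Qed.

Lemma mxReIm_eq0 n p (X : 'M[R[i]]_(n, p)) : mxRe X = 0 -> mxIm X = 0 -> X = 0.
Proof.
move=> /matrixP hr /matrixP hi; apply/matrixP => i j.
have := hr i j; have := hi i j; rewrite !mxE.
by case: (X i j) => u v /= -> ->.
Qed.

(** At a constant state the term in [dB] carries the factor [Uhat' = 0] and all coefficients are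
    real constants, so the complex problem splits into two real systems coupled only through the
    imaginary part of [lambda]. *)
Lemma constant_state_spectrally_stable r m (s : system R r m) (U0 : 'cV[R]_(r + m)) :
  A0_structure s -> hyperbolicity s -> symmetrizable s -> states s U0 ->
  spectrally_stable s (fun=> U0).
Proof.
move=> A0s hyp [S11 [S22 [_ symm]]] sU0 l l0 V [[cR cI] ode V0 V1].
have [A0u A0r _ _] := A0s _ sU0.
have [SA0 SA SB] := symm _ sU0.
set N := A0 s U0 in A0u A0r SA0 *.
pose a y := mxRe (V y); pose b y := mxIm (V y).
have BVE : (fun t => mxC (B s U0) *m cderive1 V t +
    dB s U0 (V t) *m mxC (derive1 (fun=> U0) t)) =
    (fun t => mxC (B s U0) *m cderive1 V t).
  by apply/funext => t; rewrite derive1_cst /mxC map_mx0 mulmx0 addr0.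
have odeE (x : R) : x \in `]0, 1[ ->
    [/\ is_derive x 1 a (derive1 a x), is_derive x 1 b (derive1 b x),
      is_derive x 1 (fun t => B s U0 *m derive1 a t)
       ((complex.Re l *: (N *m a x) - complex.Im l *: (N *m b x))
         + A s U0 *m derive1 a x)
    & is_derive x 1 (fun t => B s U0 *m derive1 b t)
       ((complex.Re l *: (N *m b x) + complex.Im l *: (N *m a x))
         + A s U0 *m derive1 b x)].
  move=> x01; have [[da db] _] := ode x x01; rewrite BVE => -[dBa dBb] E.
  have ha := is_derive_derive1 da; have hb := is_derive_derive1 db.
  have Ba : (fun y => mxRe (mxC (B s U0) *m cderive1 V y)) =
      (fun y => B s U0 *m derive1 a y).
    by apply/funext => y; rewrite mxRe_mulC mxRe_cderive1.
  have Bb : (fun y => mxIm (mxC (B s U0) *m cderive1 V y)) =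
      (fun y => B s U0 *m derive1 b y).
    by apply/funext => y; rewrite mxIm_mulC mxIm_cderive1.
  have Aa : derive1 (fun y => mxRe (mxC (A s U0) *m V y)) x = A s U0 *m derive1 a x.
    under eq_fun do rewrite mxRe_mulC.
    exact: is_derive1_val (is_derive_mulmxl (A s U0) ha).
  have Ab : derive1 (fun y => mxIm (mxC (A s U0) *m V y)) x = A s U0 *m derive1 b x.
    under eq_fun do rewrite mxIm_mulC.
    exact: is_derive1_val (is_derive_mulmxl (A s U0) hb).
  have EA := mxRe_cderive1 (fun y => mxC (A s U0) *m V y) x.
  have EB := mxRe_cderive1 (fun y => mxC (B s U0) *m cderive1 V y) x.
  have FA := mxIm_cderive1 (fun y => mxC (A s U0) *m V y) x.
  have FB := mxIm_cderive1 (fun y => mxC (B s U0) *m cderive1 V y) x.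
  rewrite Aa in EA; rewrite Ba in EB dBa; rewrite Ab in FA; rewrite Bb in FB dBb.
  have Ra := congr2 (fun p q => complex.Re l *: p - complex.Im l *: q)
    (mxRe_mulC N (V x)) (mxIm_mulC N (V x)).
  have Rb := congr2 (fun p q => complex.Re l *: p + complex.Im l *: q)
    (mxIm_mulC N (V x)) (mxRe_mulC N (V x)).
  have {}Ra := etrans (esym (congr2 +%R Ra EA)) (etrans (mxRe_scale_add E) EB).
  have {}Rb := etrans (esym (congr2 +%R Rb FA)) (etrans (mxIm_scale_add E) FB).
  split; [exact: ha|exact: hb| |].
  - by apply: (is_derive_eq (is_derive_derive1 dBa)); exact: (esym Ra).
  - by apply: (is_derive_eq (is_derive_derive1 dBb)); exact: (esym Rb).
move=> x x01.
have a0 : a 0 = 0 by rewrite /a V0; apply/matrixP => i j; rewrite !mxE.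
have b0 : b 0 = 0 by rewrite /b V0; apply/matrixP => i j; rewrite !mxE.
have V1E i : V 1 (rshift r i) 0 = 0.
  by move/matrixP : V1 => /(_ i 0); rewrite !mxE.
have a1 : dsubmx (a 1) = 0.
  by apply/matrixP => i j; rewrite !mxE (ord1 j) V1E.
have b1 : dsubmx (b 1) = 0.
  by apply/matrixP => i j; rewrite !mxE (ord1 j) V1E.
have [ax bx] := real_eigensystem_trivial A0u A0r SA0 SA SB (hyp _ sU0) l0 cR cI
  (fun x x01 => let: And4 h _ _ _ := odeE x x01 in h)
  (fun x x01 => let: And4 _ h _ _ := odeE x x01 in h)
  (fun x x01 => let: And4 _ _ h _ := odeE x x01 in h)
  (fun x x01 => let: And4 _ _ _ h := odeE x x01 in h) a0 b0 a1 b1 x01.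
exact: mxReIm_eq0.
Qed.

End Spectral.

(** * Nondegeneracy *)

Section ClampMatrix.
Context {R : realType}.

Lemma clampmx_lip p q (d : R) (a b : 'M[R]_(p, q)) :
  `|map_mx (clamp (- d) d) a - map_mx (clamp (- d) d) b| <= `|a - b|.
Proof.
apply/mx_norm_leP => // i j; rewrite !mxE (le_trans (clamp_lip _ _ _ _))//.
by have := mx_norm_entry (a - b) i j; rewrite !mxE.
Qed.

Lemma clampmx_le p q (d : R) (a : 'M[R]_(p, q)) : 0 <= d ->
  `|map_mx (clamp (- d) d) a| <= d.
Proof.
move=> d0; apply/mx_norm_leP => // i j; rewrite mxE ler_norml.
by apply: clamp_itv; rewrite ge0_cp.
Qed.

Lemma clampmx_id p q (d : R) (a : 'M[R]_(p, q)) :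
  `|a| <= d -> map_mx (clamp (- d) d) a = a.
Proof.
move=> ad; apply/matrixP => i j; rewrite mxE.
have := le_trans (mx_norm_entry a i j) ad.
by rewrite ler_norml => /andP[? ?]; rewrite clamp_id.
Qed.

End ClampMatrix.

(** * An abstract shooting problem near the origin *)

Section Shooting.
Context {R : realType} {n m : nat}.
Variables (p : 'cV[R]_n -> 'cV[R]_n) (J : 'M[R]_(n, m)).
Variables (h : 'cV[R]_m -> 'cV[R]_n -> 'cV[R]_m) (H : 'M[R]_(m, n)).
Let K : 'M[R]_m := H *m J.

Hypothesis p0 : p 0 = 0.
Hypothesis p_small : forall e : R, 0 < e -> exists2 d, 0 < d &
  forall a b, `|a| <= d -> `|b| <= d -> `|p a - p b| <= e * `|a - b|.
Hypothesis h_lip : exists L d : R, [/\ 0 <= L, 0 < d &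
  forall C a b, `|C| <= 1 -> `|a| <= d -> `|b| <= d ->
    `|h C a - h C b| <= L * `|a - b|].
Hypothesis h_diff : forall e : R, 0 < e -> exists2 d, 0 < d &
  forall C W, `|C| <= d -> `|W| <= d ->
    `|h C W - (H *m W + C)| <= e * (`|C| + `|W|).

(** [W] and [v] are kept side by side: [W] is recovered from [v] only near the origin, and a
    solution is not known in advance to stay there. *)
Definition shooting_solution (C : 'cV[R]_m) (W : R -> 'cV[R]_n)
    (v : R -> 'cV[R]_m) : Prop :=
  [/\ {within `[0, 1], continuous W}, {within `[0, 1], continuous v},
      W 0 = 0 /\ v 0 = 0,
      forall x : R, x \in `[0, 1] -> W x = p (W x) + J *m v x
    & forall x : R, x \in `]0, 1[ -> is_derive x 1 v (h C (W x))].

(** The variational equation at the zero solution: [Z x *m C] is the first-order response of [v x]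
    to the parameter [C]. *)
Lemma linear_shooting : exists Z : R -> 'M[R]_m,
  Z 0 = 0 /\ forall x : R, x \in `[0, 1] -> is_derive x 1 Z (K *m Z x + 1%:M).
Proof.
apply: (@picard _ _ _ (fun Z => K *m Z + 1%:M) (m%:R * `|K|)) => [|a b].
  by rewrite mulr_ge0.
by rewrite opprD addrACA subrr addr0 -mulmxBr mx_norm_mulmx.
Qed.

(* Near the origin the algebraic equation is solved by [W = phi (J v)], which
   leaves the ordinary differential equation [v' = F C v]. *)
Lemma shooting_reduction : exists (d M : R) (phi : 'cV[R]_n -> 'cV[R]_n)
    (F : 'cV[R]_m -> 'cV[R]_m -> 'cV[R]_m), [/\ 0 < d /\ 0 <= M,
  (forall W y, `|W| <= d -> (W = phi y <-> W = p W + y)) /\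
    (forall y z, `|phi y - phi z| <= 2 * `|y - z|),
  forall C v, `|phi (J *m v)| <= d -> F C v = h C (phi (J *m v)),
  (exists2 L, 0 <= L & forall C a b, `|C| <= d -> `|F C a - F C b| <= L * `|a - b|)
  & forall C (v : R -> 'cV[R]_m) a, `|C| <= d -> a <= 1 ->
    {within `[0, a], continuous v} -> v 0 = 0 ->
    (forall x : R, x \in `]0, a[ -> is_derive x 1 v (F C (v x))) ->
    forall x : R, x \in `[0, a] ->
      `|v x| <= M * `|C| /\ `|phi (J *m v x)| <= M * `|C|].
Proof.
have [d1 d1_gt0 hp] := p_small (divr_gt0 ltr01 (ltr0n _ 2)).
have [L [d2 [L0 d2_gt0 hL]]] := h_lip.
have [d3 d3_gt0 hd] := h_diff ltr01.
pose d := Num.min (Num.min d1 d2) (Num.min d3 1).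
have d_gt0 : 0 < d by rewrite /d !lt_min d1_gt0 d2_gt0 d3_gt0 ltr01.
have dd1 : d <= d1 by rewrite /d !ge_min lexx.
have dd2 : d <= d2 by rewrite /d !ge_min lexx orbT.
have dd3 : d <= d3 by rewrite /d !ge_min lexx !orbT.
have d_le1 : d <= 1 by rewrite /d !ge_min lexx !orbT.
have d0 := ltW d_gt0.
(* Composition with the retraction onto the ball of radius [d] makes the local Lipschitz bounds on
   [p] and [h] global, with constant 1/2 for [p]. *)
pose cl := @map_mx R R (clamp (- d) d) n 1.
have [phi [phiE phiU phiL]] : exists phi : 'cV[R]_n -> 'cV[R]_n,
    [/\ forall y, phi y = p (cl (phi y)) + y,
        forall w y, w = p (cl w) + y -> w = phi y
      & forall y z, `|phi y - phi z| <= 2 * `|y - z|].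
  apply: (lipschitz_perturbation_inverse (f := p \o cl)) => a b /=.
  rewrite (le_trans (hp _ _ _ _)) ?(le_trans (clampmx_le _ d0))//.
  by rewrite div1r ler_wpM2l// clampmx_lip.
have cl_id W : `|W| <= d -> cl W = W by exact: clampmx_id.
have phi0 : phi 0 = 0.
  by apply/esym/phiU; rewrite cl_id ?p0 ?addr0// normr0.
pose F C v := h C (cl (phi (J *m v))).
pose j := m%:R * `|J|.
have j0 : 0 <= j by rewrite mulr_ge0.
have phiJ a b : `|phi (J *m a) - phi (J *m b)| <= 2 * j * `|a - b|.
  rewrite (le_trans (phiL _ _))// -mulmxBr -mulrA ler_wpM2l//.
  exact: mx_norm_mulmx.
have FL C a b : `|C| <= d -> `|F C a - F C b| <= L * (2 * j) * `|a - b|.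
  move=> Cd; rewrite (le_trans (hL _ _ _ _ _ _))//.
  - exact: le_trans Cd d_le1.
  - exact: le_trans (clampmx_le _ d0) dd2.
  - exact: le_trans (clampmx_le _ d0) dd2.
  by rewrite -mulrA ler_wpM2l// (le_trans (clampmx_lip _ _ _)).
have F0 C : `|C| <= d -> `|F C 0| <= 2 * `|C|.
  move=> Cd; rewrite /F mulmx0 phi0 cl_id ?normr0//.
  have := hd C 0 (le_trans Cd dd3); rewrite normr0 => /(_ (ltW d3_gt0)).
  rewrite mulmx0 add0r addr0 mul1r => hC.
  rewrite -[h C 0](subrK C) (le_trans (ler_normD _ _))//.
  by rewrite mulr_natl mulr2n lerD2r.
have L'0 : 0 <= L * (2 * j) by rewrite !mulr_ge0.
pose G := 2 * expR (L * (2 * j) + 1).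
have G0 : 0 <= G by rewrite mulr_ge0// expR_ge0.
exists d, (Num.max G (2 * j * G)), phi, F; split=> //.
- by split=> //; rewrite le_max G0.
- split=> // W y Wd; split=> [WE|WE].
    by rewrite {1}WE phiE -WE cl_id.
  by apply: phiU; rewrite cl_id.
- by move=> C v phid; rewrite /F cl_id.
- by exists (L * (2 * j)).
(* The end point [a] is arbitrary so that the bound can be used up to a first exit time. *)
move=> C v a Cd a1 cv v0 hv x xa.
have vx : `|v x| <= G * `|C|.
  have C0 : 0 <= 2 * `|C| by rewrite mulr_ge0.
  have b (t : R) : t \in `]0, a[ -> `|F C (v t)| <= L * (2 * j) * `|v t| + 2 * `|C|.
    move=> _; rewrite -[F C (v t)](subrK (F C 0)) (le_trans (ler_normD _ _))//.
    by rewrite lerD// ?F0// (le_trans (FL _ _ _ Cd))// subr0.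
  rewrite (le_trans (gronwall L'0 C0 cv v0 hv b xa))// /G mulrAC ler_wpM2r//.
  rewrite ler_wpM2l// ler_expR ler_piMr ?addr_ge0//.
  by move: xa; rewrite in_itv/= => /andP[_ xa]; exact: le_trans xa a1.
split; first by rewrite (le_trans vx)// ler_wpM2r// le_max lexx.
have := phiJ (v x) 0; rewrite mulmx0 phi0 !subr0 => hphi.
rewrite (le_trans hphi)// (@le_trans _ _ (2 * j * (G * `|C|)))//.
  by rewrite ler_wpM2l// mulr_ge0.
by rewrite mulrA ler_wpM2r// le_max lexx orbT.
Qed.

(** Picard's theorem solves the truncated equation on all of [[0, 1]]; for small [C] the a priori
    bound keeps [W] in the ball where the truncation is inactive, so the original problem is
    solved. *)
Lemma shooting_exists (e : R) : 0 < e -> exists2 d, 0 < d &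
  forall C, `|C| <= d -> exists W v, shooting_solution C W v /\
    forall x : R, x \in `[0, 1] -> `|W x| <= e.
Proof.
move=> e0.
have [d [M [phi [F [[d0 M0] [phiP phiL] FE [L L0 FL] bound]]]]] := shooting_reduction.
have M1 : 0 < M + 1 by rewrite ltr_wpDl.
pose c := Num.min d (Num.min d e / (M + 1)).
have c0 : 0 < c by rewrite /c lt_min d0 divr_gt0// lt_min d0 e0.
exists c => // C Cc.
have Cd : `|C| <= d by rewrite (le_trans Cc)// ge_min lexx.
have MC : M * `|C| <= Num.min d e.
  rewrite (@le_trans _ _ ((M + 1) * `|C|))// ?ler_wpM2r ?lerDl//.
  by rewrite mulrC -ler_pdivlMr// (le_trans Cc)// ge_min lexx orbT.
have [v [v0 hv]] := picard L0 (fun a b => FL C a b Cd).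
have cv := derive_within_continuous hv.
have oo01 (x : R) : x \in `]0, 1[ -> x \in `[0, 1] by exact: subset_itv_oo_cc.
have hvo (x : R) : x \in `]0, 1[ -> is_derive x 1 v (F C (v x)).
  by move=> /oo01; exact: hv.
have b (x : R) (x01 : x \in `[0, 1]) := bound C v 1 Cd (lexx 1) cv v0 hvo x x01.
have phid (x : R) : x \in `[0, 1] -> `|phi (J *m v x)| <= Num.min d e.
  by move=> x01; rewrite (le_trans (b x x01).2).
have phid1 (x : R) : x \in `[0, 1] -> `|phi (J *m v x)| <= d.
  by move=> x01; rewrite (le_trans (phid x x01))// ge_min lexx.
have phi0 : phi 0 = 0.
  by apply/esym/phiP; rewrite ?normr0 ?(ltW d0)// p0 addr0.
exists (fun x => phi (J *m v x)), v; split; last first.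
  by move=> x x01; rewrite (le_trans (phid x x01))// ge_min lexx orbT.
split=> //.
- apply: (lipschitz_comp_continuous phiL).
  by move=> t; exact: (cvg_mulmx (cvg_cst J) (cv t)).
- by split=> //; rewrite v0 mulmx0.
- by move=> x x01; apply/(phiP _ _ (phid1 x x01)).
- by move=> x x01; rewrite -FE ?phid1 ?oo01//; exact: hvo.
Qed.

(* A solution leaving the ball of radius [d] would have a first exit point, up
   to which it satisfies the a priori bound, which is smaller than [d]. *)
Lemma shooting_bound : exists d M : R, [/\ 0 < d, 0 <= M &
  forall C W v, `|C| <= d -> shooting_solution C W v ->
    forall x : R, x \in `[0, 1] -> `|v x| <= M * `|C| /\ `|W x| <= M * `|C|].
Proof.
have [d [M [phi [F [[d0 M0] [phiP phiL] FE _ bound]]]]] := shooting_reduction.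
have M1 : 0 < M + 1 by rewrite ltr_wpDl.
(* Halving [d] makes [M * |C|] strictly less than [d], which contradicts an exit at norm exactly
   [d]; [M + 1] avoids dividing by zero. *)
pose c := Num.min d (d / 2 / (M + 1)).
have c0 : 0 < c by rewrite /c lt_min d0 !divr_gt0.
exists c, M; split=> // C W v Cc [cW cv [W0 v0] WE hv].
have Cd : `|C| <= d by rewrite (le_trans Cc)// ge_min lexx.
have MC : M * `|C| < d.
  rewrite (@le_lt_trans _ _ ((M + 1) * `|C|))// ?ler_wpM2r ?lerDl//.
  rewrite (@le_lt_trans _ _ (d / 2))//; last by lra.
  by rewrite mulrC -ler_pdivlMr// (le_trans Cc)// ge_min lexx orbT.
have sub (a : R) : a <= 1 -> `[0, a]%classic `<=` `[0, 1]%classic.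
  by move=> a1; apply: subset_itvl; rewrite bnd_simp.
have key (a : R) : 0 <= a -> a <= 1 ->
    (forall x : R, x \in `[0, a] -> `|W x| <= d) ->
    forall x : R, x \in `[0, a] -> `|v x| <= M * `|C| /\ `|W x| <= M * `|C|.
  move=> a0 a1 Wd x xa.
  have phiW (t : R) : t \in `[0, a] -> W t = phi (J *m v t).
    by move=> ta; apply/(phiP _ _ (Wd t ta)); apply: WE; exact: (sub a a1).
  have hv' (t : R) : t \in `]0, a[ -> is_derive t 1 v (F C (v t)).
    move=> ta; have ta' : t \in `[0, a] by exact: subset_itv_oo_cc.
    rewrite FE -phiW//; last exact: Wd.
    apply: hv; move: ta; rewrite !in_itv/= => /andP[-> ta].
    exact: lt_le_trans ta a1.
  have cva : {within `[0, a], continuous v}.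
    exact: continuous_subspaceW (sub a a1) cv.
  by rewrite (phiW x xa); exact: (bound C v a).
suff Wd (x : R) : x \in `[0, 1] -> `|W x| <= d by exact: (key 1).
move=> x01; rewrite leNgt; apply/negP => Wx.
pose g t := `|W (clamp 0 1 t)|.
have cg : continuous g.
  by move=> t; apply: cvg_norm; exact: (continuous_clamp ler01 cW).
have gE (t : R) : t \in `[0, 1] -> g t = `|W t|.
  by rewrite in_itv/= /g => /andP[? ?]; rewrite clamp_id.
pose D : set R := `[0, 1]%classic `&` [set t | d <= g t].
have cD : compact D.
  apply: (subclosed_compact _ (@segment_compact _ 0 1)); last by move=> t [].
  apply: closedI; first exact: interval_closed.
  have hg : {in ~` g @^-1` [set t | d <= t], continuous g} by move=> t _; exact: cg.
  exact: (preimage_closed hg (@closed_ge _ d)).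
have D0 : D !=set0 by exists x; split=> //=; rewrite gE// ltW.
have cid : {within D, continuous (fun t : R => t)}.
  by apply: continuous_subspaceT => t; exact: cvg_id.
have [a] := compact_EVT_min D0 cD cid.
rewrite inE => -[a01 ga] amin.
have [a0 a1] : 0 <= a /\ a <= 1 by move: a01; rewrite /= in_itv/= => /andP[].
have cga : {within `[0, a], continuous g} by exact: continuous_subspaceT.
have g0 : g 0 = 0 by rewrite gE ?W0 ?normr0// in_itv/= lexx ler01.
have gd : Num.min (g 0) (g a) <= d <= Num.max (g 0) (g a).
  by rewrite g0 ge_min (ltW d0)/= le_max ga orbT.
(* The first time [a] in [D] is reached with norm exactly [d], so [W] stays in the closed ball on
   the whole of [[0, a]], including [a]. *)
have [b ba gb] := IVT a0 cga gd.
have b01 : b \in `[0, 1] by exact: (sub a a1).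
have ab : a = b.
  apply/le_anti; rewrite amin ?inE/=; last by split=> //=; rewrite gb.
  by move: ba; rewrite in_itv/= => /andP[].
have Wa (t : R) : t \in `[0, a] -> `|W t| <= d.
  move=> ta; have t01 : t \in `[0, 1] by exact: (sub a a1).
  have [ta'|] := ltP t a.
    rewrite leNgt; apply/negP => /ltW dt.
    have tD : t \in D by rewrite inE; split=> //=; rewrite gE.
    by have := amin t tD; rewrite leNgt ta'.
  move=> at'; have -> : t = b by apply/le_anti; rewrite -{2}ab at' andbT -ab;
    move: ta; rewrite in_itv/= => /andP[].
  by rewrite -gE// gb.
have aa : a \in `[0, a] by rewrite in_itv/= a0 lexx.
have [_] := key a a0 a1 Wa a aa.
by rewrite -gE// ab gb leNgt MC.
Qed.

(** Gronwall's inequality for [v - Z C]: the residual is the linearization error of [h] plus [H]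
    applied to [p W], both small compared with [|C|] because [|W| <= M |C|]. The bound covers every
    solution with this [C], as an arbitrary choice among them demands. *)
Lemma shooting_diff (Z : R -> 'M[R]_m) (e : R) :
  Z 0 = 0 ->
  (forall x : R, x \in `[0, 1] -> is_derive x 1 Z (K *m Z x + 1%:M)) ->
  0 < e -> exists2 d, 0 < d & forall C W v, `|C| <= d ->
    shooting_solution C W v -> `|v 1 - Z 1 *m C| <= e * `|C|.
Proof.
move=> Z0 hZ e0.
have [d1 [M [d10 M0 bound]]] := shooting_bound.
pose k := m%:R * `|K|; have k0 : 0 <= k by rewrite mulr_ge0.
pose l := n%:R * `|H|; have l0 : 0 <= l by rewrite mulr_ge0.
pose E := expR ((k + 1) * 1).
(* [E] is the Gronwall factor at 1 and [1 + M + l * M] collects the residual; the final bound is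
   then [e * |C|] times [(q - 1) / q]. *)
pose q := E * (1 + M + l * M) + 1.
have E0 : 0 < E := expR_gt0 _.
have s0 : 0 <= 1 + M + l * M by rewrite !addr_ge0// mulr_ge0.
have q0 : 0 < q.
  by rewrite ltr_wpDl// mulr_ge0 ?(ltW E0).
have e'0 : 0 < e / q by rewrite divr_gt0.
have [d2 d20 hd] := h_diff e'0; have [d3 d30 hp] := p_small e'0.
have M1 : 0 < M + 1 by rewrite ltr_wpDl.
pose d := Num.min (Num.min d1 d2) (Num.min d2 d3 / (M + 1)).
exists d; first by rewrite /d !lt_min d10 d20 divr_gt0// lt_min d20 d30.
move=> C W v Cd sol.
have Cd1 : `|C| <= d1 by rewrite (le_trans Cd)// !ge_min lexx.
have Cd2 : `|C| <= d2 by rewrite (le_trans Cd)// !ge_min lexx orbT.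
have MC : M * `|C| <= Num.min d2 d3.
  rewrite (@le_trans _ _ ((M + 1) * `|C|))// ?ler_wpM2r ?lerDl//.
  by rewrite mulrC -ler_pdivlMr// (le_trans Cd)// ge_min lexx orbT.
have b := bound C W v Cd1 sol.
have [cW cv [W0 v0] WE hv] := sol.
have oo01 (x : R) : x \in `]0, 1[ -> x \in `[0, 1] by exact: subset_itv_oo_cc.
have cu : {within `[0, 1], continuous (fun t => v t - Z t *m C)}.
  have cZ := derive_within_continuous hZ.
  by move=> t; apply: cvgB; [exact: cv|exact: (cvg_mulmx (cZ t) (cvg_cst C))].
have hu (x : R) : x \in `]0, 1[ -> is_derive x 1 (fun t => v t - Z t *m C)
    (h C (W x) - (K *m Z x + 1%:M) *m C).
  move=> x01; apply: is_deriveB (hv x x01) (is_derive_mulmxr C (hZ x (oo01 x x01))).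
have u0 : v 0 - Z 0 *m C = 0 by rewrite v0 Z0 mul0mx subrr.
have r0 : 0 <= e / q * (1 + M + l * M) * `|C|.
  by rewrite mulr_ge0// mulr_ge0// ltW.
have bu (x : R) : x \in `]0, 1[ -> `|h C (W x) - (K *m Z x + 1%:M) *m C|
    <= k * `|v x - Z x *m C| + e / q * (1 + M + l * M) * `|C|.
  move=> /oo01 x01; have [bv bW] := b x x01.
  have Wd : `|W x| <= Num.min d2 d3 by exact: le_trans bW MC.
  have Wd2 : `|W x| <= d2 by rewrite (le_trans Wd)// ge_min lexx.
  have Wd3 : `|W x| <= d3 by rewrite (le_trans Wd)// ge_min lexx orbT.
  have -> : h C (W x) - (K *m Z x + 1%:M) *m C = K *m (v x - Z x *m C) +
      ((h C (W x) - (H *m W x + C)) + H *m p (W x)).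
    have -> : p (W x) = W x - J *m v x by rewrite {2}(WE x x01) addrK.
    rewrite mulmxDl mul1mx !mulmxBr !mulmxA -/K.
    move: (h C (W x)) (H *m W x) (K *m v x) (K *m Z x *m C) => s1 s2 s3 s4.
    by apply/matrixP => i i'; rewrite !mxE; ring.
  rewrite (le_trans (ler_normD _ _))// lerD//; first exact: mx_norm_mulmx.
  rewrite (le_trans (ler_normD _ _))// mulrDr mulrDl lerD//.
    rewrite (le_trans (hd _ _ Cd2 Wd2))// -[leRHS]mulrA ler_wpM2l ?(ltW e'0)//.
    by rewrite mulrDl mul1r lerD2l.
  rewrite (le_trans (mx_norm_mulmx _ _))// -/l.
  have hpW : `|p (W x)| <= e / q * (M * `|C|).
    have := hp (W x) 0 Wd3; rewrite normr0 p0 !subr0 => /(_ (ltW d30)) hW.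
    by rewrite (le_trans hW)// ler_wpM2l ?(ltW e'0).
  rewrite (le_trans (ler_wpM2l l0 hpW))//.
  by rewrite le_eqVlt; apply/orP; left; apply/eqP; ring.
have i1 : (1 : R) \in `[0, 1] by rewrite in_itv/= lexx ler01.
have := gronwall k0 r0 cu u0 hu bu i1.
move=> hfin; rewrite (le_trans hfin)// -/E.
have -> : e / q * (1 + M + l * M) * `|C| * E = e * `|C| * ((q - 1) / q).
  by rewrite /q addrK; field; rewrite gt_eqF.
rewrite ler_piMr ?mulr_ge0 ?(ltW e0)// ler_pdivrMr// mul1r.
by rewrite lerBlDr lerDl.
Qed.

End Shooting.

Section LinearShooting.
Context {R : realType} {m : nat}.

(* If [z = Z C] vanishes at 1, then [e = z^T Q z / 2 + z^T P C], whose derivative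
   is [z'^T P z'], forces [z' = 0]. *)
Lemma linear_shooting_unit (P K : 'M[R]_m) (Z : R -> 'M[R]_m) :
  (forall v : 'cV[R]_m, v != 0 -> 0 < qform P v) -> symmx (P *m K) ->
  Z 0 = 0 -> (forall x : R, x \in `[0, 1] -> is_derive x 1 Z (K *m Z x + 1%:M)) ->
  Z 1 \in unitmx.
Proof.
move=> Pp Qs Z0 hZ; apply: inj_unitmx => C ZC.
have oo01 (x : R) : x \in `]0, 1[ -> x \in `[0, 1] by exact: subset_itv_oo_cc.
have half : (2^-1 : R) \in `]0, 1[ by rewrite in_itv/=; lra.
pose z t := Z t *m C.
have hz (x : R) : x \in `[0, 1] -> is_derive x 1 z (K *m z x + C).
  move=> x01; apply: (is_derive_eq (is_derive_mulmxr C (hZ x x01))).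
  by rewrite mulmxDl mul1mx mulmxA.
have cz := derive_within_continuous hz.
pose e t := 2^-1 * qform (P *m K) (z t) + bform P (z t) C.
have he (x : R) : x \in `]0, 1[ -> is_derive x 1 e (qform P (K *m z x + C)).
  move=> /oo01 x01; have h1 := is_derive_qform Qs (hz x x01).
  have h2 := is_derive_bform P (hz x x01) (is_derive_cst C x 1).
  apply: (is_derive_eq (is_deriveD (is_deriveZ 2^-1 h1) h2)).
  rewrite bform0r addr0 (bformC _ _ Qs) -bform_mulr qformE [in RHS]bformDr.
  by rewrite /GRing.scale/=; field.
have ce : {within `[0, 1], continuous e}.
  have c1 := continuous_bform (M := P *m K) cz cz.
  have cC : {within `[0, 1], continuous (fun _ : R => C)} by move=> t; exact: cvg_cst.
  have c2 := continuous_bform (M := P) cz cC.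
  have c3 : {within `[0, 1], continuous (fun t => 2^-1 * qform (P *m K) (z t))}.
    by move=> t; apply: cvgM; [exact: cvg_cst|exact: c1].
  by move=> t; apply: cvgD; [exact: c3|exact: c2].
have de0 (x : R) : x \in `]0, 1[ -> 0 <= qform P (K *m z x + C).
  by move=> _; exact: posdef_ge0.
have e01 : e 1 <= e 0.
  by rewrite /e /z ZC Z0 mul0mx lexx.
have [deE _] := derive_ge0_eq0 ltr01 ce he de0 e01.
have dz0 (x : R) : x \in `]0, 1[ -> K *m z x + C = 0.
  by move=> x01; apply/eqP; apply: contraT => /Pp; rewrite deE// ltxx.
have hz0 (x : R) : x \in `]0, 1[ -> is_derive x 1 z 0.
  by move=> x01; rewrite -(dz0 x x01); apply: hz; exact: oo01.
have := dz0 _ half; rewrite (derive0_cst cz hz0 (oo01 _ half)) /z Z0 mul0mx.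
by rewrite mulmx0 add0r.
Qed.

End LinearShooting.

Section Local.
Context {R : realType}.

(** Everything rests on [N a - N b = N a (X b - X a) N b] for the inverses [N]. Against [N 0], and
    for [a] small enough that the difference is at most half of [|N a|], it gives
    [|N a| <= 2 |N 0|]; with this bound it then gives the Lipschitz estimate. *)
Lemma inverse_lipschitz n m (X : 'cV[R]_n -> 'M[R]_m) (k d : R) :
  0 <= k -> 0 < d ->
  (forall a, `|a| <= d -> X a \in unitmx) ->
  (forall a b, `|a| <= d -> `|b| <= d -> `|X a - X b| <= k * `|a - b|) ->
  exists c l d' : R, [/\ 0 <= c, 0 <= l, 0 < d' <= d &
    forall a b, `|a| <= d' -> `|b| <= d' ->
      `|invmx (X a)| <= c /\ `|invmx (X a) - invmx (X b)| <= l * `|a - b|].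
Proof.
move=> k0 d0 Xu Xl.
pose N a := invmx (X a); pose c0 := `|N 0|.
have c00 : 0 <= c0 by exact: normr_ge0.
have zd : `|0 : 'cV[R]_n| <= d by rewrite normr0 ltW.
pose q := m%:R * (m%:R * c0 * k).
have q0 : 0 <= q by rewrite !mulr_ge0.
have q1 : 0 < 2 * (q + 1) by rewrite mulr_gt0// ltr_wpDl.
pose d' := Num.min d (1 / (2 * (q + 1))).
have mm (x y z : 'M[R]_m) : `|x *m y *m z| <= m%:R * (m%:R * `|x| * `|y|) * `|z|.
  rewrite (le_trans (mx_norm_mulmx _ _))// ler_wpM2r// ler_wpM2l//.
  exact: mx_norm_mulmx.
have Ndiff a b : `|a| <= d -> `|b| <= d -> N a - N b = N a *m (X b - X a) *m N b.
  move=> ad bd; rewrite mulmxBr mulmxBl -[N a *m X b *m _]mulmxA mulmxV ?Xu//.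
  by rewrite mulVmx ?Xu// mulmx1 mul1mx.
have Nc a : `|a| <= d' -> `|N a| <= 2 * c0.
  move=> ad'; have ad : `|a| <= d by rewrite (le_trans ad')// ge_min lexx.
  have aq : q * `|a| <= 2^-1.
    rewrite (@le_trans _ _ ((q + 1) * `|a|))// ?ler_wpM2r ?lerDl//.
    rewrite mulrC -ler_pdivlMr ?ltr_wpDl// (le_trans ad')// ge_min.
    by rewrite -invfM div1r mulrC lexx orbT.
  have h : `|N 0 - N a| <= 2^-1 * `|N a|.
    rewrite (Ndiff _ _ zd ad) (le_trans (mm _ _ _))// ler_wpM2r//.
    rewrite (le_trans _ aq)// /q -!mulrA ler_wpM2l// ler_wpM2l//.
    rewrite -/c0 ler_wpM2l// (le_trans (Xl _ _ ad zd))// subr0//.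
  have := ler_normD (N 0) (- (N 0 - N a)); rewrite opprB addrC subrK.
  rewrite -[`|N a - N 0|]normrN opprB; move: h; rewrite -/c0; lra.
exists (2 * c0), (m%:R * (m%:R * (2 * c0)) * k * (2 * c0)), d'.
split; [by rewrite mulr_ge0|by rewrite !mulr_ge0| |move=> a b ad bd].
  by rewrite /d' ge_min lexx andbT lt_min d0 divr_gt0.
have ad1 : `|a| <= d by rewrite (le_trans ad)// ge_min lexx.
have bd1 : `|b| <= d by rewrite (le_trans bd)// ge_min lexx.
split; first exact: Nc.
rewrite -/(N a) -/(N b) (Ndiff _ _ ad1 bd1) (le_trans (mm _ _ _))//.
have -> : m%:R * (m%:R * (2 * c0)) * k * (2 * c0) * `|a - b| =
  m%:R * (m%:R * (2 * c0) * (k * `|a - b|)) * (2 * c0) by ring.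
rewrite ler_pM ?mulr_ge0//; last exact: Nc.
rewrite ler_wpM2l// ler_pM ?mulr_ge0//.
  by rewrite ler_wpM2l//; exact: Nc.
by rewrite distrC; exact: Xl.
Qed.

Lemma differentiable_at0 n p (f : 'cV[R]_n -> 'cV[R]_p) (L : 'M[R]_(p, n)) :
  (forall e : R, 0 < e -> exists2 d, 0 < d &
    forall C, `|C| <= d -> `|f C - f 0 - L *m C| <= e * `|C|) ->
  differentiable f 0 /\ Jac f 0 = L.
Proof.
move=> hf.
have cL : continuous (mulmx L : 'cV[R]_n -> 'cV[R]_p).
  move=> x; have hx : (fun y : 'cV[R]_n => y) @ x --> x by exact: cvg_id.
  exact: (cvg_mulmx (cvg_cst L) hx).
have Lo : f \o shift 0 = cst (f 0) + mulmx L +o_ (0 : 'cV[R]_n) id.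
  have -> : f \o shift 0 = f by apply/funext => y /=; rewrite addr0.
  apply/eqaddoP => e e0; have [d d0 hd] := hf e e0.
  have hn : \forall C \near (0 : 'cV[R]_n), `|C| <= d by exact: nbhs0_le.
  apply: filterS hn => C /hd.
  have -> : (f - (cst (f 0) + mulmx L)) C = f C - f 0 - L *m C.
    by rewrite -[RHS]addrA -opprD.
  by [].
have dE := diff_unique cL Lo.
have df : differentiable f 0.
  by apply/diff_locallyP; rewrite dE.
split=> //; apply/matrixP => i j; rewrite mxE deriveE// dE/=.
rewrite mxE (bigD1 j)//= mxE !eqxx mulr1 big1 ?addr0// => k kj.
by rewrite mxE (negPf kj) mulr0.
Qed.

End Local.

(** * The shooting problem of the system at a constant state *)

Section Nondegeneracy.
Context {R : realType} {r m : nat} (s : system R r m) (U0 : 'cV[R]_(r + m)).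
Local Notation state := 'cV[R]_(r + m).

Let M : 'M[R]_(r + m) := A s U0.
Let B0 : 'M[R]_m := B22 s U0.

(* With [U = U0 + W] and [v = W_II], the equation [f_I(U) = f_I(U0)] is
   [W = p W + J v], where [p] is Lipschitz with arbitrarily small constant near 0,
   and the differential equation is [v' = h C W] with [h C W] equal to [H W + C]
   up to first order. *)
Definition shooting_remainder (W : state) : state :=
  flux s (U0 + W) - flux s U0 - M *m W.

Definition shooting_p (W : state) : state :=
  - (block_mx (invmx (ulsubmx M)) 0 0 0 *m shooting_remainder W).

(** Its columns span the kernel of the first block row of [M], that is, the tangent space at [U0] of
    the set where [f_I] is constant, parametrized by [U_II]. *)
Definition shooting_J : 'M[R]_(r + m, m) :=
  col_mx (- (invmx (ulsubmx M) *m ursubmx M)) 1%:M.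

Definition shooting_h (C : 'cV[R]_m) (W : state) : 'cV[R]_m :=
  invmx (B22 s (U0 + W)) *m (dsubmx (flux s (U0 + W) - flux s U0) + B0 *m C).

Definition shooting_H : 'M[R]_(m, r + m) := invmx B0 *m dsubmx M.

Hypothesis states_open : open (states s).
Hypothesis A0s : A0_structure s.
Hypothesis smooth : smooth_system s.
Hypothesis hyp : hyperbolicity s.
Hypothesis symm : symmetrizable s.
Hypothesis sU0 : states s U0.

Lemma A11_unit : ulsubmx M \in unitmx.
Proof.
have [A0u A0r _ _] := A0s sU0; have [S11 [S22 [_ /(_ _ sU0)[SA0 SA _]]]] := symm.
have [_ pd] := S11A11_posdef A0u A0r SA0 SA (hyp sU0).
by apply: inj_unitmx => v Av; apply: (posdef_inj pd); rewrite -mulmxA Av mulmx0.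
Qed.

Lemma states_near : exists2 d, 0 < d & forall W, `|W| <= d -> states s (U0 + W).
Proof.
have /nbhs_normP[d/= d0 hd] : nbhs U0 (states s) by exact: open_nbhs_nbhs.
exists (d / 2) => [|W Wd]; first by rewrite divr_gt0.
apply: hd; rewrite /ball_/= opprD addNKr normrN.
by apply: le_lt_trans Wd _; lra.
Qed.

Lemma shooting_remainder_small (e : R) : 0 < e -> exists2 d, 0 < d &
  forall a b, `|a| <= d -> `|b| <= d ->
  `|shooting_remainder a - shooting_remainder b| <= e * `|a - b|.
Proof.
move=> e0; have [_ sfl _] := smooth.
have [d d0 hd] := strict_differentiable states_open sfl sU0 e0.
exists d => // a b ad bd.
have dfl : differentiable (flux s) U0 by exact: (sfl [::]).
have := hd (U0 + a) (U0 + b).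
have -> : U0 + a - U0 = a by rewrite addrC addKr.
have -> : U0 + b - U0 = b by rewrite addrC addKr.
have -> : U0 + a - (U0 + b) = a - b by rewrite opprD addrACA subrr add0r.
rewrite diff_Jac// mulmxBr => /(_ ad bd).
have -> // : shooting_remainder a - shooting_remainder b =
  flux s (U0 + a) - flux s (U0 + b) - (M *m a - M *m b).
by apply/matrixP => i j; rewrite !mxE; ring.
Qed.

Lemma shooting_remainder0 : shooting_remainder 0 = 0.
Proof. by rewrite /shooting_remainder addr0 subrr mulmx0 subr0. Qed.

Lemma shooting_p0 : shooting_p 0 = 0.
Proof. by rewrite /shooting_p shooting_remainder0 mulmx0 oppr0. Qed.

Lemma shooting_p_small (e : R) : 0 < e -> exists2 d, 0 < d &
  forall a b, `|a| <= d -> `|b| <= d ->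
  `|shooting_p a - shooting_p b| <= e * `|a - b|.
Proof.
move=> e0; pose E : 'M[R]_(r + m) := block_mx (invmx (ulsubmx M)) 0 0 0.
pose k := (r + m)%:R * `|E|.
have k0 : 0 <= k by rewrite mulr_ge0.
have k1 : 0 < k + 1 by rewrite ltr_wpDl.
have [d d0 hd] := shooting_remainder_small (divr_gt0 e0 k1).
exists d => // a b ad bd.
rewrite /shooting_p -opprD normrN -mulmxBr (le_trans (mx_norm_mulmx _ _))//.
rewrite (le_trans (ler_wpM2l k0 (hd a b ad bd)))// mulrA ler_wpM2r//.
by rewrite mulrCA ler_piMr ?(ltW e0)// ler_pdivrMr// mul1r lerDl.
Qed.

Lemma shooting_inverse : exists c l d : R, [/\ 0 <= c, 0 <= l, 0 < d &
  forall a b, `|a| <= d -> `|b| <= d -> `|invmx (B22 s (U0 + a))| <= c /\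
    `|invmx (B22 s (U0 + a)) - invmx (B22 s (U0 + b))| <= l * `|a - b|].
Proof.
have [_ _ sB] := smooth.
have [k [d1 [k0 d10 hk]]] := locally_lipschitz states_open sB sU0.
have [d2 d20 hs] := states_near.
pose d := Num.min d1 d2.
have d0 : 0 < d by rewrite lt_min d10.
have [|a b ad bd|c [l [d' [c0 l0 /andP[d'0 _] h]]]] :=
  @inverse_lipschitz R _ m (fun W => B22 s (U0 + W)) k d k0 d0.
- move=> a ad; apply: (B22_unit symm); apply: hs.
  by rewrite (le_trans ad)// ge_min lexx orbT.
- have ad1 : `|U0 + a - U0| <= d1.
    by rewrite [U0 + a]addrC addrK (le_trans ad)// ge_min lexx.
  have bd1 : `|U0 + b - U0| <= d1.
    by rewrite [U0 + b]addrC addrK (le_trans bd)// ge_min lexx.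
  have := hk _ _ ad1 bd1; rewrite opprD addrACA subrr add0r; apply: le_trans.
  (* Smoothness is assumed of the full matrix [B], of which [B22] is a block. *)
  have BE W i j : B22 s W i j = B s W (rshift r i) (rshift r j).
    by rewrite /B block_mxEdr.
  have subE k1 k2 (X Y : 'M[R]_(k1, k2)) i j : (X - Y) i j = X i j - Y i j.
    by rewrite !mxE.
  apply/mx_norm_leP => // i j; rewrite subE !BE -subE.
  exact: mx_norm_entry.
- by exists c, l, d'.
Qed.

Lemma shooting_flux_lip : exists k d : R, [/\ 0 <= k, 0 < d &
  forall a b, `|a| <= d -> `|b| <= d ->
    `|dsubmx (flux s (U0 + a) - flux s U0) -
      dsubmx (flux s (U0 + b) - flux s U0)| <= k * `|a - b|].
Proof.
have [_ sfl _] := smooth.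
have [k [d [k0 d0 hk]]] := locally_lipschitz states_open sfl sU0.
exists k, d; split=> // a b ad bd.
have ad1 : `|U0 + a - U0| <= d by rewrite [U0 + a]addrC addrK.
have bd1 : `|U0 + b - U0| <= d by rewrite [U0 + b]addrC addrK.
have := hk _ _ ad1 bd1; rewrite opprD addrACA subrr add0r; apply: le_trans.
rewrite -linearB/= opprB addrA subrK.
exact: mx_norm_dsubmx.
Qed.

Lemma shooting_h_lip : exists L d : R, [/\ 0 <= L, 0 < d &
  forall C a b, `|C| <= 1 -> `|a| <= d -> `|b| <= d ->
    `|shooting_h C a - shooting_h C b| <= L * `|a - b|].
Proof.
have [c [l [d1 [c0 l0 d10 hN]]]] := shooting_inverse.
have [k [d2 [k0 d20 hG]]] := shooting_flux_lip.
pose d := Num.min d1 d2; have d0 : 0 < d by rewrite lt_min d10.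
(* [y] bounds the second factor of [shooting_h], which grows with [C]; hence the restriction to
   [|C| <= 1]. *)
pose y := k * d2 + m%:R * `|B0|.
have y0 : 0 <= y by rewrite addr_ge0// mulr_ge0// ltW.
exists (m%:R * c * k + m%:R * l * y), d; split=> //.
  by rewrite addr_ge0// ?mulr_ge0.
move=> C a b C1 ad bd.
have ad1 : `|a| <= d1 by rewrite (le_trans ad)// ge_min lexx.
have bd1 : `|b| <= d1 by rewrite (le_trans bd)// ge_min lexx.
have ad2 : `|a| <= d2 by rewrite (le_trans ad)// ge_min lexx orbT.
have bd2 : `|b| <= d2 by rewrite (le_trans bd)// ge_min lexx orbT.
have [Na Nab] := hN a b ad1 bd1; have Gab := hG a b ad2 bd2.
rewrite /shooting_h.
move: (invmx (B22 s (U0 + a))) (invmx (B22 s (U0 + b))) Na Nab => na nb Na Nab.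
have yb : `|dsubmx (flux s (U0 + b) - flux s U0) + B0 *m C| <= y.
  rewrite (le_trans (ler_normD _ _))// lerD//.
    have := hG b 0 bd2; rewrite normr0 addr0 subrr linear0 !subr0 => /(_ (ltW d20)).
    by move=> h; rewrite (le_trans h)// ler_wpM2l.
  by rewrite (le_trans (mx_norm_mulmx _ _))// ler_piMr// mulr_ge0.
move: (dsubmx (flux s (U0 + a) - flux s U0)) Gab => ga.
move: (dsubmx (flux s (U0 + b) - flux s U0)) yb => gb yb Gab.
have -> : na *m (ga + B0 *m C) - nb *m (gb + B0 *m C) =
    na *m (ga - gb) + (na - nb) *m (gb + B0 *m C).
  rewrite mulmxBr mulmxBl !mulmxDr.
  move: (na *m ga) (na *m gb) (nb *m gb) (na *m (B0 *m C)) (nb *m (B0 *m C)).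
  by move=> x1 x2 x3 x4 x5; apply/matrixP => i j; rewrite !mxE; ring.
rewrite (le_trans (ler_normD _ _))// mulrDl lerD//.
  rewrite (le_trans (mx_norm_mulmx _ _))// -!mulrA ler_wpM2l//.
  by rewrite ler_pM.
rewrite (le_trans (mx_norm_mulmx _ _))// -!mulrA ler_wpM2l//.
by rewrite [y * _]mulrC mulrA ler_pM.
Qed.

(** The error splits into the inverse of [B22] applied to the flux remainder, which is small
    relative to [|W|], and the variation of that inverse applied to the linear part [z], which is
    quadratic in [(C, W)]. Each receives half of [e]. *)
Lemma shooting_h_diff (e : R) : 0 < e -> exists2 d, 0 < d &
  forall C W, `|C| <= d -> `|W| <= d ->
    `|shooting_h C W - (shooting_H *m W + C)| <= e * (`|C| + `|W|).
Proof.
move=> e0.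
have [c [l [d1 [c0 l0 d10 hN]]]] := shooting_inverse.
have B0u : B0 \in unitmx by exact: B22_unit.
pose e1 := e / 2 / (m%:R * c + 1).
have mc0 : 0 <= m%:R * c by rewrite mulr_ge0.
have mc1 : 0 < m%:R * c + 1 by rewrite ltr_wpDl.
have e10 : 0 < e1 by rewrite !divr_gt0.
have [d2 d20 hR] := shooting_remainder_small e10.
pose y := (r + m)%:R * `|dsubmx M| + m%:R * `|B0|.
have y0 : 0 <= y by rewrite addr_ge0// mulr_ge0.
pose q := m%:R * l * y.
have q0 : 0 <= q by rewrite !mulr_ge0.
have q1 : 0 < q + 1 by rewrite ltr_wpDl.
have d30 : 0 < e / 2 / (q + 1) by rewrite !divr_gt0.
exists (Num.min d1 (Num.min d2 (e / 2 / (q + 1)))).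
  by rewrite !lt_min d10 d20 d30.
move=> C W Cd Wd.
have Wd1 : `|W| <= d1 by rewrite (le_trans Wd)// ge_min lexx.
have Wd2 : `|W| <= d2 by rewrite (le_trans Wd)// !ge_min lexx orbT.
have Wd3 : `|W| <= e / 2 / (q + 1) by rewrite (le_trans Wd)// !ge_min lexx !orbT.
have zd1 : `|0 : state| <= d1 by rewrite normr0 ltW.
have [Na Nab] := hN W 0 Wd1 zd1.
have := hR W 0 Wd2 _; rewrite shooting_remainder0 !subr0 normr0.
move=> /(_ (ltW d20)) rW; rewrite addr0 subr0 in Nab.
pose z := dsubmx M *m W + B0 *m C.
have zle : `|z| <= y * (`|C| + `|W|).
  rewrite (le_trans (ler_normD _ _))// mulrDl lerD//.
    by rewrite (le_trans (mx_norm_mulmx _ _))// ler_wpM2l ?mulr_ge0// lerDr.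
  by rewrite (le_trans (mx_norm_mulmx _ _))// ler_wpM2l ?mulr_ge0// lerDl.
have -> : shooting_h C W - (shooting_H *m W + C) =
    invmx (B22 s (U0 + W)) *m dsubmx (shooting_remainder W)
    + (invmx (B22 s (U0 + W)) - invmx B0) *m z.
  have -> : dsubmx (shooting_remainder W) =
      dsubmx (flux s (U0 + W) - flux s U0) - dsubmx M *m W.
    by rewrite /shooting_remainder linearB/= mul_dsub_mx.
  rewrite /shooting_h /shooting_H /z mulmxBl !mulmxDr mulmxN mulKmx//.
  move: (invmx (B22 s (U0 + W)) *m (dsubmx M *m W)) => x1.
  move: (invmx (B22 s (U0 + W)) *m (B0 *m C)) => x2.
  move: (invmx (B22 s (U0 + W)) *m dsubmx (flux s (U0 + W) - flux s U0)) => x3.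
  rewrite -mulmxA; move: (invmx B0 *m (dsubmx M *m W)) => x4.
  by apply/matrixP => i j; rewrite !mxE; ring.
have -> : e * (`|C| + `|W|) = e / 2 * (`|C| + `|W|) + e / 2 * (`|C| + `|W|).
  by field.
have CW0 : 0 <= `|C| + `|W| by rewrite addr_ge0.
have e20 : 0 <= e / 2 by rewrite divr_ge0// ltW.
rewrite (le_trans (ler_normD _ _))// lerD//.
  rewrite (le_trans (mx_norm_mulmx _ _))//.
  rewrite (@le_trans _ _ (m%:R * c * (e1 * `|W|)))//.
    rewrite ler_pM ?mulr_ge0// ?ler_wpM2l//.
    exact: le_trans (mx_norm_dsubmx _) rW.
  have h1 : m%:R * c * e1 <= e / 2.
    by rewrite /e1 mulrCA ler_piMr// ler_pdivrMr// mul1r lerDl.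
  have h2 : 0 <= m%:R * c * e1 := mulr_ge0 mc0 (ltW e10).
  by rewrite mulrA ler_pM// lerDr.
rewrite (le_trans (mx_norm_mulmx _ _))//.
rewrite (@le_trans _ _ (m%:R * (l * `|W|) * (y * (`|C| + `|W|))))//.
  by rewrite ler_pM ?mulr_ge0// ler_wpM2l.
have -> : m%:R * (l * `|W|) * (y * (`|C| + `|W|)) = q * `|W| * (`|C| + `|W|).
  by rewrite /q; ring.
rewrite ler_wpM2r// (le_trans (ler_wpM2l q0 Wd3))//.
by rewrite mulrCA ler_piMr// ler_pdivrMr// mul1r lerDl.
Qed.

(** The second block of the equation reads [W_II = v]. Once this holds, the linear terms of the
    first block cancel and leave [A11^-1 (f_I(U0 + W) - f_I(U0)) = 0]. The equivalence is exact, for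
    [W] of any size. *)
Lemma shooting_algebraic (W : state) (v : 'cV[R]_m) :
  W = shooting_p W + shooting_J *m v <->
  dsubmx W = v /\ usubmx (flux s (U0 + W)) = usubmx (flux s U0).
Proof.
have Au := A11_unit.
have [f fE0] : exists f, f = usubmx (flux s (U0 + W)) - usubmx (flux s U0).
  by eexists.
have pE : shooting_p W + shooting_J *m v = col_mx
    (usubmx W - invmx (ulsubmx M) *m f
     + invmx (ulsubmx M) *m ursubmx M *m (dsubmx W - v)) v.
  have -> : shooting_J *m v = col_mx (- (invmx (ulsubmx M) *m ursubmx M) *m v) v.
    by rewrite /shooting_J mul_col_mx mul1mx.
  rewrite /shooting_p /shooting_remainder.
  rewrite -[_ - _ - _ in LHS]vsubmxK mul_block_col !mul0mx !addr0.
  rewrite opp_col_mx oppr0 add_col_mx add0r; congr col_mx.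
  have -> : usubmx (flux s (U0 + W) - flux s U0 - M *m W) =
      f - (ulsubmx M *m usubmx W + ursubmx M *m dsubmx W).
    by rewrite -usubmx_A fE0 -!linearB.
  rewrite mulmxBr mulmxDr mulKmx// [_ *m (dsubmx W - v)]mulmxBr mulNmx !mulmxA.
  move: (invmx (ulsubmx M) *m f) => x1.
  move: (invmx (ulsubmx M) *m ursubmx M *m dsubmx W) => x2.
  move: (invmx (ulsubmx M) *m ursubmx M *m v) (usubmx W) => x3 x4.
  by apply/matrixP => i j; rewrite !mxE; ring.
rewrite pE; split=> [WE|[Wv fE]].
  have Wv : dsubmx W = v by rewrite WE col_mxKd.
  split=> //; have := congr1 usubmx WE; rewrite col_mxKu Wv subrr mulmx0 addr0.
  move/eqP; rewrite -subr_eq0 opprB addrC subrK => /eqP f0.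
  by apply/eqP; rewrite -subr_eq0 -fE0 -[f](mulKVmx Au) f0 mulmx0.
by rewrite fE0 fE Wv !subrr !mulmx0 subr0 addr0 -Wv vsubmxK.
Qed.

Lemma shoot_shooting_solution (C : 'cV[R]_m) (U : R -> state) : shoot s U0 C U ->
  shooting_solution shooting_p shooting_J shooting_h C
    (fun x => U x - U0) (fun x => dsubmx (U x) - dsubmx U0).
Proof.
move=> [sU cU Ux0 fE ode].
have UE (x : R) : U0 + (U x - U0) = U x by rewrite addrC subrK.
split.
- by move=> x; apply: cvgB; [exact: cU|exact: cvg_cst].
- move=> x; apply: cvgB; last exact: cvg_cst.
  by apply: cvg_dsubmx; exact: cU.
- by rewrite Ux0 !subrr.
- by move=> x x01; apply/shooting_algebraic; rewrite UE linearB/=; split; [|exact: fE].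
- move=> x x01; have [dU E] := ode x x01.
  have sx : states s (U x) by apply: sU; exact: subset_itv_oo_cc x01.
  have hd := is_derive_derive1 dU.
  apply: (is_derive_eq (is_deriveB hd (is_derive_cst (dsubmx U0) x 1))).
  by rewrite subr0 /shooting_h UE linearB/= -E mulKmx// (B22_unit symm sx).
Qed.

Lemma shooting_solution_shoot (C : 'cV[R]_m) (W : R -> state) (v : R -> 'cV[R]_m) :
  shooting_solution shooting_p shooting_J shooting_h C W v ->
  (forall x : R, x \in `[0, 1] -> states s (U0 + W x)) ->
  shoot s U0 C (fun x => U0 + W x).
Proof.
move=> [cW cv [W0 v0] WE hv] sW.
have oo01 (x : R) : x \in `]0, 1[ -> x \in `[0, 1] by exact: subset_itv_oo_cc.
have vE (x : R) : x \in `[0, 1] -> dsubmx (W x) = v x.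
  by move=> /WE/shooting_algebraic[].
split=> //.
- by move=> x; apply: cvgD; [exact: cvg_cst|exact: cW].
- by rewrite W0 addr0.
- by move=> x /WE/shooting_algebraic[].
- move=> x x01.
  have hd : is_derive x 1 (fun y => dsubmx (U0 + W y)) (shooting_h C (W x)).
    have h1 : is_derive x 1 (fun y => dsubmx U0 + v y) (shooting_h C (W x)).
      apply: (is_derive_eq (is_deriveD (is_derive_cst (dsubmx U0) x 1) (hv x x01))).
      by rewrite add0r.
    apply: (is_derive_near x01 _ h1) => t t01.
    by rewrite linearD/= vE//; exact: oo01.
  split; first by case: hd.
  rewrite (is_derive1_val hd) /shooting_h mulKVmx ?linearB//.
  by apply: (B22_unit symm); apply: sW; exact: oo01.
Qed.

(** [H J] is [B0^-1] times the Schur complement [A22 - A21 A11^-1 A12]. With [P = S22 B0], the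
    factor [B0] cancels, and since the first block of [M J] is zero, [P H J = J^T (S A) J], which
    inherits the symmetry of [S A]. *)
Lemma shooting_unit (Z : R -> 'M[R]_m) : Z 0 = 0 ->
  (forall x : R, x \in `[0, 1] ->
    is_derive x 1 Z (shooting_H *m shooting_J *m Z x + 1%:M)) ->
  Z 1 \in unitmx.
Proof.
have [S11 [S22 [_ /(_ _ sU0)[_ SA /symmetrized_posdef SB]]]] := symm.
have B0u : B0 \in unitmx by exact: B22_unit.
apply: (linear_shooting_unit SB).
pose S : 'M[R]_(r + m) := block_mx (S11 U0) 0 0 (S22 U0).
have -> : S22 U0 *m B0 *m (shooting_H *m shooting_J) =
    shooting_J^T *m (S *m M) *m shooting_J.
  have MJ : M *m shooting_J = col_mx 0 (dsubmx M *m shooting_J).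
    rewrite -[LHS]vsubmxK mul_dsub_mx; congr col_mx.
    rewrite usubmx_A col_mxKu col_mxKd mulmx1 mulmxN mulmxA mulmxV ?A11_unit//.
    by rewrite mul1mx addNr.
  rewrite /shooting_H -!mulmxA MJ mulKVmx// mul_block_col !mul0mx mulmx0 !add0r.
  by rewrite /shooting_J tr_col_mx mul_row_col mulmx0 add0r trmx1 mul1mx.
have SME : (S *m M)^T = S *m M by exact: SA.
by rewrite /symmx trmx_mul trmx_mul trmxK SME mulmxA.
Qed.

Lemma constant_root_nondegenerate :
  nondegenerate_root s U0 (dsubmx U0) 0.
Proof.
have [d1 d10 hs] := states_near.
have [d2 d20 hex] := shooting_exists shooting_J shooting_p0 shooting_p_small shooting_h_lip
  shooting_h_diff d10.
have ne C : `|C| <= d2 -> shoot s U0 C !=set0.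
  move=> /hex[W [v [sol Wd]]]; exists (fun x => U0 + W x).
  by apply: (shooting_solution_shoot sol) => x x01; apply: hs; exact: Wd.
have [Z [Z0 hZ]] := linear_shooting shooting_J shooting_H.
have small (e : R) : 0 < e -> exists2 d, 0 < d & forall C, `|C| <= d ->
    `|Psi s U0 (dsubmx U0) C - Z 1 *m C| <= e * `|C|.
  move=> e0; have [d d0 hd] := shooting_diff shooting_p0 shooting_p_small
    shooting_h_lip shooting_h_diff Z0 hZ e0.
  exists (Num.min d d2) => [|C]; first by rewrite lt_min d0.
  rewrite le_min => /andP[Cd Cd2].
  have [U shU] := ne C Cd2.
  have ex : exists y, [set dsubmx (U 1) - dsubmx U0 | U in shoot s U0 C] y.
    by exists (dsubmx (U 1) - dsubmx U0); exists U.
  (* [V] is an unspecified member of [shoot], possibly different from the constructed [U]; the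
     first-order estimate applies to it all the same. *)
  have [V shV VE] := xgetPex 0 ex.
  by rewrite /Psi -VE; exact: hd C _ _ Cd (shoot_shooting_solution shV).
(* At [C = 0] the estimate bounds the norm of [Psi] by 0. *)
have Psi0 : Psi s U0 (dsubmx U0) 0 = 0.
  have [d d0 /(_ 0)] := small 1 ltr01.
  rewrite normr0 mulmx0 subr0 mulr0 normr_le0 => /(_ (ltW d0)).
  by move/eqP.
have [dPsi JPsi] : differentiable (Psi s U0 (dsubmx U0)) 0 /\
    Jac (Psi s U0 (dsubmx U0)) 0 = Z 1.
  apply: differentiable_at0 => e e0; have [d d0 hd] := small e e0.
  by exists d => // C Cd; rewrite Psi0 subr0; exact: hd.
split=> //.
  have hn : \forall C \near (0 : 'cV[R]_m), `|C| <= d2 by exact: nbhs0_le.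
  by apply: filterS hn => C; exact: ne.
by rewrite JPsi mxrank_unit// shooting_unit.
Qed.

End Nondegeneracy.

Theorem theorem2p11 (R : realType) (r m : nat) (s : system R r m)
    (states_open : open (states s))
    (A0_block : A0_structure s)
    (Ha : smooth_system s)
    (Hb : parabolicity s)
    (Hc : hyperbolicity s)
    (Hd : symmetrizable s)
    (Hentropy : has_convex_entropy s)
    (HfI : fI_injective s)
    (U0 : 'cV[R]_(r + m)) (HU0 : states s U0) :
  let U0II := dsubmx U0 in
  [/\ steady_solution s U0 U0II (fun=> U0),
      forall U : R -> 'cV[R]_(r + m), steady_solution s U0 U0II U ->
        forall x : R, x \in `[0, 1] -> U x = U0,
      nondegenerate_root s U0 U0II 0
    & spectrally_stable s (fun=> U0)].
Proof.
move=> U0II; split.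
- have BU : (fun y : R => B s U0 *m derive1 (fun=> U0) y) = cst 0.
    by apply/funext => y; rewrite derive1_cst mulmx0.
  split=> //.
  + by move=> x; exact: cvg_cst.
  + move=> x _; rewrite BU; split; [exact: derivable_cst|exact: derivable_cst|].
    by rewrite !derive1_cst.
- by move=> U; exact: steady_solution_constant.
- exact: constant_root_nondegenerate.
- exact: constant_state_spectrally_stable.
Qed.
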